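(* Let $k\ge1$ and $W=\mathbb{Q}w_1\oplus\dots\oplus\mathbb{Q}w_k$ with $|w_i|=2$. Let $M=(S(V),d)\in\mathrm{DGCA}^{\mathrm{sf}}$ and $N\in\mathrm{DGCA}^{\mathrm{sf}}_{S(W)}$. (i) There is a natural bijection $$\mathrm{Hom}^0_{\mathrm{DGCA}^{\mathrm{sf}}}\big(M,\mathrm{Tot}_k(N)\big)\ \xrightarrow{\ \sim\ }\ \mathrm{Hom}_{\mathrm{DGCA}^{\mathrm{sf}}_{S(W)}}\big(\mathrm{Trd}_k(M),N\big),$$ where $$\mathrm{Hom}^0_{\mathrm{DGCA}^{\mathrm{sf}}}\big(M,\mathrm{Tot}_k(N)\big):=\big\{f\in\mathrm{Hom}_{\mathrm{DGCA}^{\mathrm{sf}}}\big(M,\mathrm{Tot}_k(N)\big)\ \big|\ f(M^+)\subset N^+\otimes S(sW)\big\}.$$ (ii) This bijection induces a bijection on the homotopy classes of maps, where a homotopy on $\mathrm{Hom}^0$ is a DGCA homomorphism $h:M\to\mathrm{Tot}_k(N)\otimes\Omega(1)$ such that $$h(M^+)\subset\big(N\otimes\Omega(1)\big)^+\otimes S(sW).$$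
   Context: All algebras are over $\mathbb{Q}$; differentials have degree $+1$; DGCA = differential graded commutative algebra (unital); $S(V)$ is the free graded commutative algebra on a graded vector space $V$; $A^+:=\bigoplus_{n>0}A^n$. $\mathrm{DGCA}^{\mathrm{sf}}$ is the category of semifree DGCAs, i.e. those free as graded commutative algebras, so that each object has the form $M=(S(V),d)$. View $S(W)=\mathbb{Q}[w_1,\dots,w_k]$ as a DGCA with zero differential; $\mathrm{DGCA}^{\mathrm{sf}}_{S(W)}$ is the category of DGCAs over $S(W)$ that are free as graded commutative $S(W)$-algebras, with morphisms the DGCA homomorphisms over $S(W)$. Truncated algebraic toroidification: let $\mathbb{Q}[s_1,\dots,s_k]$ be the free graded commutative algebra on variables of degree $-1$. For $M=(S(V),d)$, $$\mathrm{Trd}_k(M):=\big(S\big((\mathbb{Q}[s_1,\dots,s_k]\otimes V)^{>0}\big)\otimes\mathbb{Q}[w_1,\dots,w_k],\,d_t\big),$$ where ${}^{>0}$ denotes the positive-degree part (elements of $\mathbb{Q}[s_1,\dots,s_k]\otimes V$ of degree $\le0$ being dropped, i.e. read as $0$ in the formulas); the multiplication operators $s_i$ on $(\mathbb{Q}[s_1,\dots,s_k]\otimes V)^{>0}$ are extended to the whole algebra as degree $-1$ derivations with $s_iw_j=0$ for all $j$; and $d_t$ is the degree $+1$ derivation determined by $d_tv=dv+\sum_{i=1}^kw_i\cdot s_iv$ for $v\in V$, $[d_t,s_i]=d_ts_i+s_id_t=0$, and $d_tw_i=0$ for $1\le i\le k$. Totalization: $\mathrm{Tot}_k(N):=N\otimes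 S(sW)$, where $sW$ has basis $sw_1,\dots,sw_k$ with $|sw_i|=1$, and the differential extends that of $N$ by $d(sw_i)=w_i$ (the image of $w_i$ in $N$). Homotopies: $\Omega(1)=\mathbb{Q}[t,dt]$ is the DGCA of polynomial differential forms on the interval. A homotopy $A\to B\otimes\Omega(1)$ is between its restrictions at $t=0$ and $t=1$; on the right-hand side homotopies are morphisms $\mathrm{Trd}_k(M)\to N\otimes\Omega(1)$ over $S(W)$. Homotopy classes are taken with respect to the equivalence relation generated by homotopy.
   Formalization: V is assumed concentrated in positive degrees (the claim fails e.g. for M=S(v), |v|=0, d=0, N=S(W)), and M ranges over those for which the clauses defining d_t are consistent, i.e. Trd_k(M) exists (they clash e.g. for k=1, |v|=1, |y|=2, dv=y). *)

(* Defs.v *)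
From Stdlib Require Import Relation_Operators.
From HB Require Import structures.
From mathcomp Require Import all_boot all_order all_algebra.
From mathcomp Require Import zify.
From mathcomp Require Import boolp classical_sets functions.
Set Implicit Arguments.
Unset Strict Implicit.
Unset Printing Implicit Defensive.
Import Order.TTheory GRing.Theory Num.Theory.
Local Open Scope quotient_scope.
Local Open Scope classical_set_scope.
Local Open Scope ring_scope.

(* A graded rational vector space V is given by a homogeneous basis: a type of
   generators, each with its degree. *)
Record gbasis := GBasis { gen :> Type; deg : gen -> int }.

Definition koszul (m n : int) : rat := (-1) ^+ (`|m| * `|n|)%N.

(** ** The free graded commutative algebra S(V) *)

(* S(V) is presented by generators and relations: expressions in the
   generators, modulo the least congruence containing the axioms of associative
   unital Q-algebras and graded commutativity of the generators.  Over Q, the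
   latter implies that odd generators square to zero. *)
Inductive expr (X : gbasis) :=
| EVar of X
| ECst of rat
| EAdd of expr X & expr X
| EMul of expr X & expr X.
Arguments ECst {X}.

Inductive econg (X : gbasis) : expr X -> expr X -> Prop :=
| ec_refl a : econg a a
| ec_sym a b : econg a b -> econg b a
| ec_trans a b c : econg a b -> econg b c -> econg a c
| ec_add a a' b b' : econg a a' -> econg b b' -> econg (EAdd a b) (EAdd a' b')
| ec_mul a a' b b' : econg a a' -> econg b b' -> econg (EMul a b) (EMul a' b')
| ec_addA a b c : econg (EAdd a (EAdd b c)) (EAdd (EAdd a b) c)
| ec_addC a b : econg (EAdd a b) (EAdd b a)
| ec_add0 a : econg (EAdd (ECst 0) a) a
| ec_mulA a b c : econg (EMul a (EMul b c)) (EMul (EMul a b) c)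
| ec_mul1 a : econg (EMul (ECst 1) a) a
| ec_mul0 a : econg (EMul (ECst 0) a) (ECst 0)
| ec_mulDl a b c : econg (EMul (EAdd a b) c) (EAdd (EMul a c) (EMul b c))
| ec_mulDr a b c : econg (EMul a (EAdd b c)) (EAdd (EMul a b) (EMul a c))
| ec_cstD p q : econg (ECst (p + q)) (EAdd (ECst p) (ECst q))
| ec_cstM p q : econg (ECst (p * q)) (EMul (ECst p) (ECst q))
| ec_cstC p a : econg (EMul (ECst p) a) (EMul a (ECst p))
| ec_gcomm x y :
    econg (EMul (EVar x) (EVar y))
          (EMul (ECst (koszul (deg x) (deg y))) (EMul (EVar y) (EVar x))).

HB.instance Definition _ (X : gbasis) := gen_eqMixin (expr X).
HB.instance Definition _ (X : gbasis) := gen_choiceMixin (expr X).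

Section FreeAlgebra.
Variable X : gbasis.

Definition erel (a b : expr X) : bool := `[< econg a b >].

Lemma erel_equiv : equiv_class_of erel.
Proof.
split=> [a|a b|b a c].
- by apply/asboolP; exact: ec_refl.
- by apply/asboolP/asboolP; exact: ec_sym.
- by move=> /asboolP ab /asboolP bc; apply/asboolP; exact: ec_trans bc.
Qed.

Canonical erel_equiv_rel := EquivRelPack erel_equiv.

Definition fgca := {eq_quot erel}.
HB.instance Definition _ := Choice.on fgca.
HB.instance Definition _ := Quotient.on fgca.

Definition ecls (a : expr X) : fgca := \pi_fgca a.

Lemma eclsP a b : ecls a = ecls b <-> econg a b.
Proof.
split=> [/eqmodP/asboolP //|ab]; by apply/eqmodP/asboolP.
Qed.

Lemma ecls_repr x : ecls (repr x) = x.
Proof. exact: reprK. Qed.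

Lemma repr_ecls a : econg (repr (ecls a)) a.
Proof. by apply/eclsP; rewrite ecls_repr. Qed.

Definition fadd (x y : fgca) := ecls (EAdd (repr x) (repr y)).
Definition fmul (x y : fgca) := ecls (EMul (repr x) (repr y)).
Definition fopp (x : fgca) := ecls (EMul (ECst (-1)) (repr x)).
Definition fscale (c : rat) (x : fgca) := ecls (EMul (ECst c) (repr x)).

Lemma eclsD a b : fadd (ecls a) (ecls b) = ecls (EAdd a b).
Proof. by apply/eclsP; apply: ec_add; exact: repr_ecls. Qed.

Lemma eclsM a b : fmul (ecls a) (ecls b) = ecls (EMul a b).
Proof. by apply/eclsP; apply: ec_mul; exact: repr_ecls. Qed.

Lemma eclsN a : fopp (ecls a) = ecls (EMul (ECst (-1)) a).
Proof. by apply/eclsP; apply: ec_mul; [exact: ec_refl|exact: repr_ecls]. Qed.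

Lemma eclsZ c a : fscale c (ecls a) = ecls (EMul (ECst c) a).
Proof. by apply/eclsP; apply: ec_mul; [exact: ec_refl|exact: repr_ecls]. Qed.

Lemma fgca_ind (P : fgca -> Prop) : (forall a, P (ecls a)) -> forall x, P x.
Proof. by move=> H x; rewrite -(ecls_repr x). Qed.

Lemma faddA : associative fadd.
Proof.
elim/fgca_ind=> a; elim/fgca_ind=> b; elim/fgca_ind=> c.
by rewrite !eclsD; apply/eclsP; exact: ec_addA.
Qed.
Lemma faddC : commutative fadd.
Proof.
elim/fgca_ind=> a; elim/fgca_ind=> b.
by rewrite !eclsD; apply/eclsP; exact: ec_addC.
Qed.
Lemma fadd0 : left_id (ecls (ECst 0)) fadd.
Proof. by elim/fgca_ind=> a; rewrite eclsD; apply/eclsP; exact: ec_add0. Qed.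

Lemma faddN : left_inverse (ecls (ECst 0)) fopp fadd.
Proof.
elim/fgca_ind=> a; rewrite eclsN eclsD; apply/eclsP.
apply: (@ec_trans _ _ (EAdd (EMul (ECst (-1)) a) (EMul (ECst 1) a))).
  by apply: ec_add; [exact: ec_refl|apply: ec_sym; exact: ec_mul1].
apply: ec_trans (ec_sym (ec_mulDl _ _ _)) _.
apply: (@ec_trans _ _ (EMul (ECst (-1 + 1)) a)).
  by apply: ec_mul; [apply: ec_sym; exact: ec_cstD|exact: ec_refl].
by rewrite addNr; exact: ec_mul0.
Qed.

HB.instance Definition _ := GRing.isZmodule.Build fgca faddA faddC fadd0 faddN.

Lemma fmulA : associative fmul.
Proof.
elim/fgca_ind=> a; elim/fgca_ind=> b; elim/fgca_ind=> c.
by rewrite !eclsM; apply/eclsP; exact: ec_mulA.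
Qed.
Lemma fmul1 : left_id (ecls (ECst 1)) fmul.
Proof. by elim/fgca_ind=> a; rewrite eclsM; apply/eclsP; exact: ec_mul1. Qed.
Lemma fmulr1 : right_id (ecls (ECst 1)) fmul.
Proof.
elim/fgca_ind=> a; rewrite eclsM; apply/eclsP.
by apply: ec_trans (ec_sym (ec_cstC _ _)) _; exact: ec_mul1.
Qed.
Lemma fmulDl : left_distributive fmul fadd.
Proof.
elim/fgca_ind=> a; elim/fgca_ind=> b; elim/fgca_ind=> c.
by rewrite !(eclsM, eclsD); apply/eclsP; exact: ec_mulDl.
Qed.
Lemma fmulDr : right_distributive fmul fadd.
Proof.
elim/fgca_ind=> a; elim/fgca_ind=> b; elim/fgca_ind=> c.
by rewrite !(eclsM, eclsD); apply/eclsP; exact: ec_mulDr.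
Qed.

(* The augmentation killing all generators; it shows that S(V) is nonzero. *)
Fixpoint eaug (a : expr X) : rat :=
  match a with
  | EVar _ => 0
  | ECst c => c
  | EAdd a b => eaug a + eaug b
  | EMul a b => eaug a * eaug b
  end.

Lemma eaug_cong a b : econg a b -> eaug a = eaug b.
Proof.
by elim=> //= *; rewrite ?(mul0r, mulr0, mul1r, add0r, addrA, mulrA, mulrDl,
  mulrDr) //; congruence || (rewrite addrC || rewrite mulrC).
Qed.

Lemma fone_neq0 : ecls (ECst 1) != 0.
Proof. by apply/eqP => /eclsP/eaug_cong/eqP; rewrite /= oner_eq0. Qed.

HB.instance Definition _ := GRing.Zmodule_isNzRing.Build fgca
  fmulA fmul1 fmulr1 fmulDl fmulDr fone_neq0.

Lemma fscaleE c x : fscale c x = ecls (ECst c) * x.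
Proof. by elim/fgca_ind: x => a; rewrite eclsZ /GRing.mul /= eclsM. Qed.

Lemma eclsDE a b : ecls (EAdd a b) = ecls a + ecls b.
Proof. by rewrite -eclsD. Qed.
Lemma eclsME a b : ecls (EMul a b) = ecls a * ecls b.
Proof. by rewrite -eclsM. Qed.
Lemma ecls_cstD p q : ecls (ECst (p + q)) = ecls (ECst p) + ecls (ECst q).
Proof. by rewrite -eclsDE; apply/eclsP; exact: ec_cstD. Qed.
Lemma ecls_cstM p q : ecls (ECst (p * q)) = ecls (ECst p) * ecls (ECst q).
Proof. by rewrite -eclsME; apply/eclsP; exact: ec_cstM. Qed.
Lemma ecls_cstC p x : ecls (ECst p) * x = x * ecls (ECst p).
Proof.
by elim/fgca_ind: x => a; rewrite -!eclsME; apply/eclsP; exact: ec_cstC.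
Qed.

Lemma fscaleA a b v : fscale a (fscale b v) = fscale (a * b) v.
Proof. by rewrite !fscaleE ecls_cstM mulrA. Qed.
Lemma fscale1 : left_id 1 fscale.
Proof. by move=> x; rewrite fscaleE; exact: mul1r. Qed.
Lemma fscaleDr : right_distributive fscale +%R.
Proof. by move=> a x y; rewrite !fscaleE mulrDr. Qed.
Lemma fscaleDl v : {morph fscale^~ v : a b / a + b}.
Proof. by move=> a b /=; rewrite !fscaleE ecls_cstD mulrDl. Qed.

HB.instance Definition _ := GRing.Zmodule_isLmodule.Build rat fgca
  fscaleA fscale1 fscaleDr fscaleDl.

Lemma fscaleAl (c : rat) (x y : fgca) : c *: (x * y) = c *: x * y.
Proof. by rewrite /GRing.scale /= !fscaleE mulrA. Qed.
HB.instance Definition _ := GRing.Lmodule_isLalgebra.Build rat fgca fscaleAl.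

Lemma fscaleAr (c : rat) (x y : fgca) : c *: (x * y) = x * (c *: y).
Proof. by rewrite /GRing.scale /= !fscaleE mulrA ecls_cstC !mulrA. Qed.
HB.instance Definition _ := GRing.Lalgebra_isAlgebra.Build rat fgca fscaleAr.

Definition var (x : X) : fgca := ecls (EVar x).

Lemma ecls_cst c : ecls (ECst c) = c%:A.
Proof. by rewrite /GRing.scale /= fscaleE mulr1. Qed.

Lemma fgca_scaleE (c : rat) (x : fgca) : c *: x = ecls (ECst c) * x.
Proof. exact: fscaleE. Qed.

Lemma var_gcomm (x y : X) :
  var x * var y = koszul (deg x) (deg y) *: (var y * var x).
Proof.
rewrite fgca_scaleE /var -(eclsME (EVar x)) -(eclsME (EVar y)) -eclsME.
by apply/eclsP; exact: ec_gcomm.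
Qed.

Lemma fgca_gen_ind (P : fgca -> Prop) :
  (forall x, P (var x)) -> (forall c : rat, P c%:A) ->
  (forall a b, P a -> P b -> P (a + b)) ->
  (forall a b, P a -> P b -> P (a * b)) -> forall a, P a.
Proof.
move=> Pv Pc Pa Pm; elim/fgca_ind; elim=> [x|c|a IHa b IHb|a IHa b IHb].
- exact: Pv.
- by rewrite ecls_cst.
- by rewrite eclsDE; exact: Pa.
- by rewrite eclsME; exact: Pm.
Qed.

End FreeAlgebra.

(* The grading of S(V): the least one for which S(V) is a graded algebra and
   each generator has its own degree. *)
Inductive homog (X : gbasis) : int -> fgca X -> Prop :=
| hg_var x : homog (deg x) (var x)
| hg_one : homog 0 1
| hg_zero n : homog n 0
| hg_add n a b : homog n a -> homog n b -> homog n (a + b)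
| hg_scale n (c : rat) a : homog n a -> homog n (c *: a)
| hg_mul m n a b : homog m a -> homog n b -> homog (m + n) (a * b).

(* The algebra homomorphism extending f.  It depends on the chosen
   representative unless the values of f commute as the generators do, which is
   always the case below. *)
Fixpoint elift (X : gbasis) (B : algType rat) (f : X -> B) (a : expr X) : B :=
  match a with
  | EVar x => f x
  | ECst c => c%:A
  | EAdd a b => elift f a + elift f b
  | EMul a b => elift f a * elift f b
  end.

Definition lift (X : gbasis) (B : algType rat) (f : X -> B) (a : fgca X) : B :=
  elift f (repr a).

(* The automorphism a |-> (-1)^(n |a|) a. *)
Definition twist (X : gbasis) (n : int) : fgca X -> fgca X :=
  lift (fun x => koszul n (deg x) *: var x).

(* The degree n derivation extending v, where v x has degree deg x + n. *)
Fixpoint eder (X : gbasis) (n : int) (v : X -> fgca X) (a : expr X) : fgca X :=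
  match a with
  | EVar x => v x
  | ECst _ => 0
  | EAdd a b => eder n v a + eder n v b
  | EMul a b => eder n v a * ecls b + twist n (ecls a) * eder n v b
  end.

Definition der (X : gbasis) (n : int) (v : X -> fgca X) (a : fgca X) : fgca X :=
  eder n v (repr a).

Definition is_derivation (X : gbasis) (n : int) (D : fgca X -> fgca X) :=
  [/\ linear D,
      forall m a, homog m a -> homog (m + n) (D a) &
      forall m a b, homog m a -> D (a * b) = D a * b + koszul n m *: (a * D b)].

Definition is_algmor (X Y : gbasis) (f : fgca X -> fgca Y) :=
  [/\ linear f, f 1 = 1, {morph f : a b / a * b} &
      forall n a, homog n a -> homog n (f a)].

Section Extension.
Implicit Types X Y : gbasis.

Lemma koszulC m n : koszul m n = koszul n m.
Proof. by rewrite /koszul mulnC. Qed.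

Lemma koszul0 n : koszul 0 n = 1.
Proof. by rewrite /koszul absz0 mul0n. Qed.

Lemma koszulE m n : koszul m n = (-1) ^+ (odd `|m| && odd `|n|).
Proof. by rewrite /koszul -signr_odd oddM. Qed.

Lemma koszulDl m n p : koszul (m + n) p = koszul m p * koszul n p.
Proof.
have E : odd `|m + n| = odd `|m| (+) odd `|n| by lia.
by rewrite !koszulE E -signr_addb; congr (_ ^+ _); do 3!case: odd.
Qed.

Lemma koszulDr m n p : koszul m (n + p) = koszul m n * koszul m p.
Proof. by rewrite koszulC koszulDl !(koszulC m). Qed.

Lemma koszul_sq m n : koszul m n * koszul m n = 1.
Proof. by rewrite koszulE -expr2 sqrr_sign. Qed.

Lemma homog_gcomm X m n (a b : fgca X) :
  homog m a -> homog n b -> a * b = koszul m n *: (b * a).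
Proof.
move=> Ha; elim: Ha n b => {m a} [x||m|m a b _ IHa _ IHb|m c a _ IHa|
    m1 m2 a b _ IHa _ IHb] n e He.
- elim: He => {n e} [y||n|n a b _ IHa _ IHb|n c a _ IHa|n1 n2 a b _ IHa _ IHb].
  + exact: var_gcomm.
  + by rewrite mulr1 mul1r koszulC koszul0 scale1r.
  + by rewrite mulr0 mul0r scaler0.
  + by rewrite mulrDr mulrDl scalerDr IHa IHb.
  + by rewrite -scalerAr IHa -scalerAl !scalerA mulrC.
  + rewrite mulrA IHa -scalerAl -(mulrA a (var x) b) IHb -scalerAr scalerA mulrA.
    by rewrite koszulDr.
- by rewrite mulr1 mul1r koszul0 scale1r.
- by rewrite mulr0 mul0r scaler0.
- by rewrite mulrDr mulrDl scalerDr (IHa _ _ He) (IHb _ _ He).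
- by rewrite -scalerAl (IHa _ _ He) -scalerAr !scalerA mulrC.
- rewrite -(mulrA a b e) (IHb _ _ He) -scalerAr (mulrA a e b) (IHa _ _ He).
  by rewrite -scalerAl scalerA (mulrA e a b) koszulDl mulrC.
Qed.

Inductive hsum X : fgca X -> Prop :=
| hs_nil : hsum 0
| hs_cons n a b : homog n a -> hsum b -> hsum (a + b).

Lemma hsumP X (a : fgca X) : hsum a.
Proof.
have hsD (b c : fgca X) : hsum b -> hsum c -> hsum (b + c).
  elim=> [|n u v Hu _ IH] Hc; first by rewrite add0r.
  by rewrite -addrA; apply: hs_cons Hu _; exact: IH.
have hs1 n (b : fgca X) : homog n b -> hsum b.
  by move=> Hb; rewrite -[b]addr0; apply: hs_cons Hb _; exact: hs_nil.
elim/fgca_gen_ind: a => [x|c|a b|a b Ha Hb].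
- by apply: hs1; exact: hg_var.
- by apply: (@hs1 0); apply: hg_scale; exact: hg_one.
- exact: hsD.
- elim: Ha => [|m u v Hu _ IH]; first by rewrite mul0r; exact: hs_nil.
  rewrite mulrDl; apply: hsD IH; elim: Hb => [|n y z Hy _ IH].
    by rewrite mulr0; exact: hs_nil.
  by rewrite mulrDr; apply: hs_cons IH; exact: hg_mul Hu Hy.
Qed.

Lemma elift_cong X (B : algType rat) (f : X -> B) :
  (forall x y, f x * f y = koszul (deg x) (deg y) *: (f y * f x)) ->
  forall a b, econg a b -> elift f a = elift f b.
Proof.
move=> Hf a b; elim=> {a b} //=.
- by move=> a b c _ -> _ ->.
- by move=> a a' b b' _ -> _ ->.
- by move=> a a' b b' _ -> _ ->.
- by move=> *; rewrite addrA.
- by move=> *; rewrite addrC.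
- by move=> *; rewrite scale0r add0r.
- by move=> *; rewrite mulrA.
- by move=> *; rewrite scale1r mul1r.
- by move=> *; rewrite scale0r mul0r.
- by move=> *; rewrite mulrDl.
- by move=> *; rewrite mulrDr.
- by move=> *; rewrite scalerDl.
- by move=> *; rewrite -scalerAl mul1r scalerA.
- by move=> *; rewrite -scalerAl mul1r -scalerAr mulr1.
- by move=> x y; rewrite -[RHS]scalerAl mul1r Hf.
Qed.

Section LiftAlg.
Variables (X : gbasis) (B : algType rat) (f : X -> B).
Hypothesis Hf : forall x y, f x * f y = koszul (deg x) (deg y) *: (f y * f x).

Lemma lift_ecls a : lift f (ecls a) = elift f a.
Proof. by apply: elift_cong => //; exact: repr_ecls. Qed.

Lemma lift_var x : lift f (var x) = f x.
Proof. exact: lift_ecls. Qed.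

Lemma lift_cst (c : rat) : lift f c%:A = c%:A.
Proof. by rewrite -ecls_cst lift_ecls. Qed.

Lemma lift1 : lift f 1 = 1.
Proof. by have := lift_cst 1; rewrite !scale1r. Qed.

Lemma liftD a b : lift f (a + b) = lift f a + lift f b.
Proof.
elim/fgca_ind: a => a; elim/fgca_ind: b => b.
by rewrite -eclsDE !lift_ecls.
Qed.

Lemma liftM a b : lift f (a * b) = lift f a * lift f b.
Proof.
elim/fgca_ind: a => a; elim/fgca_ind: b => b.
by rewrite -eclsME !lift_ecls.
Qed.

Lemma lift_linear : linear (lift f).
Proof.
move=> c a b; rewrite liftD; congr (_ + _).
by rewrite -[c *: a]mul1r -scalerAr scalerAl liftM lift_cst -scalerAl mul1r.
Qed.
End LiftAlg.

Lemma lift_algmor X Y (f : X -> fgca Y) :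
  (forall x, homog (deg x) (f x)) ->
  is_algmor (lift f) /\ forall x, lift f (var x) = f x.
Proof.
move=> Hf.
have Hc x y : f x * f y = koszul (deg x) (deg y) *: (f y * f x).
  exact: homog_gcomm.
have Hl := lift_linear Hc; split; last exact: lift_var.
split=> //; [exact: lift1|exact: liftM|].
have H0 : lift f 0 = 0 by have := lift_cst Hc 0; rewrite !scale0r.
move=> n a; elim=> {n a} [x||n|n a b _ IHa _ IHb|n c a _ IHa|
    m n a b _ IHa _ IHb].
- by rewrite lift_var.
- by rewrite lift1 //; exact: hg_one.
- by rewrite H0; exact: hg_zero.
- by rewrite liftD //; exact: hg_add.
- by rewrite -[c *: a]addr0 Hl H0 addr0; exact: hg_scale.
- by rewrite liftM //; exact: hg_mul.
Qed.

Lemma algmor_eq X Y (f g : fgca X -> fgca Y) :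
  is_algmor f -> is_algmor g -> (forall x, f (var x) = g (var x)) -> f = g.
Proof.
move=> [lf f1 fM _] [lg g1 gM _] fg; apply/funext.
have f0 : f 0 = 0 by have := lf (-1) 0 0; rewrite scaler0 addr0 scaleN1r addNr.
have g0 : g 0 = 0 by have := lg (-1) 0 0; rewrite scaler0 addr0 scaleN1r addNr.
elim/fgca_gen_ind => [//|c|a b Ha Hb|a b Ha Hb].
- by rewrite -[c%:A]addr0 lf lg f0 g0 f1 g1.
- by rewrite -[a]scale1r lf lg Ha Hb.
- by rewrite fM gM Ha Hb.
Qed.

Section Twist.
Variables (X : gbasis) (n : int).

Let tw_comm (x y : X) :
  (koszul n (deg x) *: var x) * (koszul n (deg y) *: var y) =
  koszul (deg x) (deg y) *:
    ((koszul n (deg y) *: var y) * (koszul n (deg x) *: var x)).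
Proof.
rewrite -!scalerAl -!scalerAr !scalerA var_gcomm scalerA.
by rewrite [X in X *: _]mulrC mulrA [X in X *: _]mulrAC.
Qed.

Lemma twist_homog m (a : fgca X) : homog m a -> twist n a = koszul n m *: a.
Proof.
have Hl := lift_linear tw_comm.
have H0 : twist n (0 : fgca X) = 0.
  by have := lift_cst tw_comm 0; rewrite !scale0r.
elim=> {m a} [x||m|m a b _ IHa _ IHb|m c a _ IHa|m p a b _ IHa _ IHb].
- exact: (lift_var tw_comm).
- by rewrite koszulC koszul0 scale1r; exact: (lift1 tw_comm).
- by rewrite H0 scaler0.
- by rewrite /twist (liftD tw_comm) -!/(twist n _) IHa IHb scalerDr.
- rewrite -[c *: a]addr0 /twist Hl -!/(twist n _) H0 IHa !addr0 !scalerA.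
  by rewrite mulrC.
- rewrite /twist (liftM tw_comm) -!/(twist n _) IHa IHb -scalerAl -scalerAr.
  rewrite scalerA.
  by rewrite koszulDr.
Qed.

Lemma twistD (a b : fgca X) : twist n (a + b) = twist n a + twist n b.
Proof. exact: (liftD tw_comm). Qed.
Lemma twistM (a b : fgca X) : twist n (a * b) = twist n a * twist n b.
Proof. exact: (liftM tw_comm). Qed.
Lemma twist_cst (c : rat) : twist n (c%:A : fgca X) = c%:A.
Proof. exact: (lift_cst tw_comm). Qed.
End Twist.

Section Der.
Variables (X : gbasis) (n : int) (v : X -> fgca X).
Hypothesis Hv : forall x, homog (deg x + n) (v x).

Lemma eder_cong a b : econg a b -> eder n v a = eder n v b.
Proof.
elim=> {a b} //=.
- by move=> a b c _ -> _ ->.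
- by move=> a a' b b' _ -> _ ->.
- move=> a a' b b' Ha -> Hb ->.
  by move/eclsP: Ha => ->; move/eclsP: Hb => ->.
- by move=> *; rewrite addrA.
- by move=> *; rewrite addrC.
- by move=> *; rewrite add0r.
- by move=> a b c; rewrite !eclsME twistM mulrDr mulrDl !mulrA addrA.
- by move=> a; rewrite mul0r add0r ecls_cst twist_cst scale1r mul1r.
- by move=> a; rewrite mul0r add0r ecls_cst twist_cst scale0r mul0r.
- by move=> a b c; rewrite eclsDE twistD !mulrDl addrACA.
- by move=> a b c; rewrite eclsDE !mulrDr addrACA.
- by rewrite add0r.
- by move=> p q; rewrite mul0r mulr0 add0r.
- move=> p a; rewrite mul0r mulr0 add0r addr0 ecls_cst twist_cst.
  by rewrite -scalerAl mul1r -scalerAr mulr1.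
- move=> x y; rewrite mul0r add0r ecls_cst twist_cst -[RHS]scalerAl mul1r.
  rewrite -!/(var _) !(twist_homog _ (hg_var _)) -!scalerAl scalerDr addrC.
  congr (_ + _).
    rewrite (homog_gcomm (hg_var x) (Hv y)) scalerA koszulDr mulrC -mulrA.
    by rewrite (koszulC n) koszul_sq mulr1.
  rewrite (homog_gcomm (Hv x) (hg_var y)) koszulDl scalerA.
  by congr (_ *: _).
Qed.

Lemma der_ecls a : der n v (ecls a) = eder n v a.
Proof. by apply: eder_cong; exact: repr_ecls. Qed.

Lemma der_var x : der n v (var x) = v x.
Proof. exact: der_ecls. Qed.

Lemma der_twist a b : der n v (a * b) = der n v a * b + twist n a * der n v b.
Proof.
elim/fgca_ind: a => a; elim/fgca_ind: b => b.
by rewrite -eclsME !der_ecls.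
Qed.

Lemma derP : is_derivation n (der n v).
Proof.
have derD a b : der n v (a + b) = der n v a + der n v b.
  elim/fgca_ind: a => a; elim/fgca_ind: b => b.
  by rewrite -eclsDE !der_ecls.
have dercst (c : rat) : der n v c%:A = 0 by rewrite -ecls_cst der_ecls.
have derZ (c : rat) a : der n v (c *: a) = c *: der n v a.
  rewrite -[c *: a]mul1r -scalerAr scalerAl der_twist dercst mul0r add0r.
  by rewrite twist_cst -scalerAl mul1r.
have der0 : der n v 0 = 0 by have := dercst 0; rewrite scale0r.
split=> [c a b|m a|m a b Ha]; first by rewrite derD derZ.
  elim=> {m a} [x||m|m a b _ IHa _ IHb|m c a _ IHa|m p a b Ha IHa Hb IHb].
  - by rewrite der_var; exact: Hv.
  - by have := dercst 1; rewrite scale1r => ->; exact: hg_zero.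
  - by rewrite der0; exact: hg_zero.
  - by rewrite derD; exact: hg_add.
  - by rewrite derZ; exact: hg_scale.
  - rewrite der_twist (twist_homog _ Ha); apply: hg_add.
      by rewrite addrAC; exact: hg_mul IHa Hb.
    by rewrite -scalerAl -addrA; apply/hg_scale; exact: hg_mul Ha IHb.
by rewrite der_twist (twist_homog _ Ha) scalerAl.
Qed.
End Der.

Section DerTheory.
Variables (X : gbasis) (n : int) (D : fgca X -> fgca X).
Hypothesis HD : is_derivation n D.

Lemma derD a b : D (a + b) = D a + D b.
Proof. by case: HD => lD _ _; rewrite -[a in LHS]scale1r lD scale1r. Qed.
Lemma der0 : D 0 = 0.
Proof. by apply: (addrI (D 0)); rewrite -derD !addr0. Qed.
Lemma derZ c a : D (c *: a) = c *: D a.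
Proof. by case: HD => lD _ _; rewrite -[c *: a]addr0 lD der0 addr0. Qed.
Lemma derN a : D (- a) = - D a.
Proof. by rewrite -!scaleN1r derZ. Qed.
Lemma der1 : D 1 = 0.
Proof.
case: HD => _ _ /(_ 0 1 1 (hg_one _)).
rewrite mulr1 koszulC koszul0 scale1r mul1r mulr1 => E.
by apply: (addrI (D 1)); rewrite addr0 -E.
Qed.
Lemma der_sum (I : Type) (r : seq I) (P : pred I) (F : I -> fgca X) :
  D (\sum_(i <- r | P i) F i) = \sum_(i <- r | P i) D (F i).
Proof. by elim/big_rec2: _ => [|i a b _ <-]; rewrite ?der0 ?derD. Qed.
Lemma derM a b : D (a * b) = D a * b + twist n a * D b.
Proof.
case: HD => _ _ HM; elim: (hsumP a) => [|m u w Hu _ IH].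
  have -> : twist n (0 : fgca X) = 0.
    by have := @twist_cst X n 0; rewrite scale0r.
  by rewrite !mul0r der0 mul0r addr0.
rewrite mulrDl !derD twistD IH (HM _ _ _ Hu) (twist_homog _ Hu).
by rewrite !mulrDl scalerAl addrACA.
Qed.
End DerTheory.

Lemma derivation_eq X n (D E : fgca X -> fgca X) :
  is_derivation n D -> is_derivation n E ->
  (forall x, D (var x) = E (var x)) -> D = E.
Proof.
move=> HD HE DE; apply/funext; elim/fgca_gen_ind => [//|c|a b Ha Hb|a b Ha Hb].
- by rewrite (derZ HD) (derZ HE) (der1 HD) (der1 HE).
- by rewrite (derD HD) (derD HE) Ha Hb.
- by rewrite (derM HD) (derM HE) Ha Hb.
Qed.

Lemma der_twist_comm X n m (D : fgca X -> fgca X) a : is_derivation n D ->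
  D (twist m a) = koszul m n *: twist m (D a).
Proof.
move=> HD; have [_ Hdeg _] := HD.
have tw0 : twist m (0 : fgca X) = 0 by have := @twist_cst X m 0; rewrite scale0r.
elim: (hsumP a) => [|p u w Hu _ IH]; first by rewrite tw0 !(der0 HD) tw0 scaler0.
rewrite twistD !(derD HD) twistD scalerDr IH; congr (_ + _).
rewrite (twist_homog _ Hu) (twist_homog _ (Hdeg _ _ Hu)) (derZ HD) scalerA.
by rewrite koszulDr mulrCA koszul_sq mulr1.
Qed.

Lemma twistK X n (a : fgca X) : twist n (twist n a) = a.
Proof.
have tw0 : twist n (0 : fgca X) = 0 by have := @twist_cst X n 0; rewrite scale0r.
have twZ c (b : fgca X) : twist n (c *: b) = c *: twist n b.
  by rewrite -[c *: b]mul1r -scalerAr scalerAl twistM twist_cst -scalerAl mul1r.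
elim: (hsumP a) => [|p u w Hu _ IH]; first by rewrite !tw0.
by rewrite !twistD IH (twist_homog _ Hu) twZ (twist_homog _ Hu) scalerA koszul_sq scale1r.
Qed.

Lemma derivation_sq0 X (D : fgca X -> fgca X) :
  is_derivation 1 D -> (forall x, D (D (var x)) = 0) -> forall a, D (D a) = 0.
Proof.
move=> HD D2; elim/fgca_gen_ind => [//|c|a b Ha Hb|a b Ha Hb].
- by rewrite (derZ HD) (der1 HD) scaler0 (der0 HD).
- by rewrite !(derD HD) Ha Hb addr0.
rewrite (derM HD) (derD HD) !(derM HD) Ha Hb mul0r mulr0 add0r addr0.
by rewrite (der_twist_comm _ _ HD) /koszul expr1 scaleN1r mulNr addrN.
Qed.
End Extension.

(** ** Semifree DGCAs *)

Record sdgca := SDgca {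
  sd_gens :> gbasis;
  diff : fgca sd_gens -> fgca sd_gens;
  diffP : is_derivation 1 diff;
  diff_sq : forall a, diff (diff a) = 0 }.
Arguments diff {s}.

Definition dhom (A B : sdgca) : set (fgca A -> fgca B) :=
  [set f | is_algmor f /\ forall a, f (diff a) = diff (f a)].
Arguments dhom : clear implicits.

(* S(V) (x) S(V') is realised as S(V (+) V'), and ren applied to an inclusion
   of generators is the corresponding inclusion of a tensor factor. *)
Definition gsum (X Y : gbasis) :=
  GBasis (fun z : X + Y => match z with inl x => deg x | inr y => deg y end).

Definition ren (X Y : gbasis) (f : X -> Y) : fgca X -> fgca Y :=
  lift (fun x => var (f x)).

Inductive span (V : lmodType rat) (B : set V) : set V :=
| span0 : span B 0
| span_cons c b v : B b -> span B v -> span B (c *: b + v).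

(* A^+ *)
Definition positive_part (A : sdgca) : set (fgca A) :=
  span [set a | exists2 n, 0 < n & homog n a].
Arguments positive_part : clear implicits.

Definition positively_generated (A : sdgca) := forall x : A, 0 < deg x.

(** ** Semifree DGCAs over S(W) *)

Definition Wgen (k : nat) := GBasis (fun _ : 'I_k => 2 : int).
Definition sWgen (k : nat) := GBasis (fun _ : 'I_k => 1 : int).

Definition w (k : nat) (U : gbasis) (i : 'I_k) : fgca (gsum U (Wgen k)) :=
  var (inr i : gsum U (Wgen k)).

(* S(U) (x) S(W) with a differential that vanishes on W. *)
Record sdgcaW (k : nat) := SDgcaW {
  rel_gens : gbasis;
  diffW : fgca (gsum rel_gens (Wgen k)) -> fgca (gsum rel_gens (Wgen k));
  diffWP : is_derivation 1 diffW;
  diffW_sq : forall a, diffW (diffW a) = 0;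
  diffW_w : forall i, diffW (w rel_gens i) = 0 }.

Definition sdgca_of_W (k : nat) (N : sdgcaW k) : sdgca :=
  SDgca (@diffWP k N) (@diffW_sq k N).
Coercion sdgca_of_W : sdgcaW >-> sdgca.

Definition dhomW (k : nat) (N N' : sdgcaW k) : set (fgca N -> fgca N') :=
  [set f | dhom N N' f /\ forall i, f (w _ i) = w _ i].
Arguments dhomW {k} N N'.

Section Intertwine.
Implicit Types X Y : gbasis.

Lemma lin0 (U V : lmodType rat) (f : U -> V) : linear f -> f 0 = 0.
Proof. by move=> /(_ (-1) 0 0); rewrite scaler0 addr0 scaleN1r addNr. Qed.

Lemma linD (U V : lmodType rat) (f : U -> V) a b :
  linear f -> f (a + b) = f a + f b.
Proof. by move=> lf; rewrite -[a in LHS]scale1r lf scale1r. Qed.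

Lemma linZ (U V : lmodType rat) (f : U -> V) c a :
  linear f -> f (c *: a) = c *: f a.
Proof. by move=> lf; rewrite -[c *: a]addr0 lf (lin0 lf) addr0. Qed.

Lemma twist0 X n : twist n (0 : fgca X) = 0.
Proof. by have := @twist_cst X n 0; rewrite scale0r. Qed.

Lemma algmor_twist X Y (f : fgca X -> fgca Y) n a :
  is_algmor f -> f (twist n a) = twist n (f a).
Proof.
case=> lf f1 _ fh.
elim: (hsumP a) => [|p u v Hu _ IH]; first by rewrite (lin0 lf) !twist0 (lin0 lf).
rewrite twistD (twist_homog _ Hu) lf IH (linD _ _ lf) twistD.
by rewrite (twist_homog _ (fh _ _ Hu)).
Qed.

Lemma der_algmor X Y n (f : fgca X -> fgca Y) D E :
  is_algmor f -> is_derivation n D -> is_derivation n E ->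
  (forall x, E (f (var x)) = f (D (var x))) -> forall a, E (f a) = f (D a).
Proof.
move=> Hf HD HE H; have [lf f1 fM _] := Hf.
elim/fgca_gen_ind => [//|c|a b Ha Hb|a b Ha Hb].
- by rewrite (linZ _ _ lf) f1 (derZ HE) (derZ HD) (der1 HE) (der1 HD) !scaler0 (lin0 lf).
- by rewrite (linD _ _ lf) (derD HE) (derD HD) (linD _ _ lf) Ha Hb.
- by rewrite fM (derM HE) (derM HD) (linD _ _ lf) !fM Ha Hb (algmor_twist _ _ Hf).
Qed.

Lemma algmor_ren X Y (f : X -> Y) : (forall x, deg (f x) = deg x) ->
  is_algmor (ren f) /\ forall x, ren f (var x) = var (f x).
Proof. by move=> H; apply: lift_algmor => x; rewrite -H; exact: hg_var. Qed.
End Intertwine.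

(** ** Totalization *)

Section Tot.
Variables (k : nat) (N : sdgcaW k).

Definition tot_gens := gsum N (sWgen k).
Definition tot_N : fgca N -> fgca tot_gens := ren (inl : N -> tot_gens).
Definition tot_sW : fgca (sWgen k) -> fgca tot_gens :=
  ren (inr : sWgen k -> tot_gens).

Definition tot_diff : fgca tot_gens -> fgca tot_gens :=
  der 1 (fun z : tot_gens =>
    match z with
    | inl y => tot_N (diff (var y))
    | inr i => tot_N (w _ i)
    end).

Let tot_NP : is_algmor tot_N /\ forall y, tot_N (var y) = var (inl y : tot_gens).
Proof. exact: algmor_ren. Qed.

Lemma tot_diff_deg (z : tot_gens) : homog (deg z + 1)
  match z with
  | inl y => tot_N (diff (var y))
  | inr i => tot_N (w _ i)
  end.
Proof.
have [[_ _ _ fh] fv] := tot_NP.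
case: z => [y|i] /=; last by apply: fh; exact: (hg_var (inr i : N)).
by apply: fh; have [_ h _] := diffP N; apply: h; exact: hg_var.
Qed.

Lemma tot_diffP : is_derivation 1 tot_diff.
Proof. exact: derP tot_diff_deg. Qed.

Lemma tot_diff_N a : tot_diff (tot_N a) = tot_N (diff a).
Proof.
have [fm fv] := tot_NP; apply: der_algmor => //; [exact: diffP|exact: tot_diffP|].
by move=> y; rewrite fv; exact: (der_var tot_diff_deg (inl y : tot_gens)).
Qed.

Lemma tot_diff_sq a : tot_diff (tot_diff a) = 0.
Proof.
have [[lf _ _ _] _] := tot_NP.
have f0 := lin0 lf.
apply: derivation_sq0 => [|z]; first exact: tot_diffP.
rewrite [tot_diff (var z)](der_var tot_diff_deg) .
by case: z => [y|i]; rewrite tot_diff_N ?diff_sq ?f0 //= (diffW_w N i).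
Qed.

Definition Tot : sdgca := SDgca tot_diffP tot_diff_sq.

(* N^+ (x) S(sW) *)
Definition tot_positive : set (fgca Tot) :=
  span [set tot_N a * tot_sW p | a in positive_part N & p in setT].

End Tot.
Arguments tot_positive {k} N.

Definition Tot_map (k : nat) (N N' : sdgcaW k) (psi : fgca N -> fgca N') :
    fgca (Tot N) -> fgca (Tot N') :=
  lift (fun z : Tot N =>
    match z with
    | inl y => @tot_N k N' (psi (var y))
    | inr i => var (inr i : Tot N')
    end).

(** ** Tensoring with Omega(1) *)

Variant omega_gen := Ot | Odt.
Definition Omega1 :=
  GBasis (fun z => match z with Ot => 0 : int | Odt => 1 : int end).

Section Cyl.
Variable A : sdgca.

Definition cyl_gens := gsum A Omega1.
Definition cyl_A : fgca A -> fgca cyl_gens := ren (inl : A -> cyl_gens).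

Definition cyl_diff : fgca cyl_gens -> fgca cyl_gens :=
  der 1 (fun z : cyl_gens =>
    match z with
    | inl y => cyl_A (diff (var y))
    | inr Ot => var (inr Odt : cyl_gens)
    | inr Odt => 0
    end).

Let cyl_AP : is_algmor cyl_A /\ forall y, cyl_A (var y) = var (inl y : cyl_gens).
Proof. exact: algmor_ren. Qed.

Lemma cyl_diff_deg (z : cyl_gens) : homog (deg z + 1)
  match z with
  | inl y => cyl_A (diff (var y))
  | inr Ot => var (inr Odt : cyl_gens)
  | inr Odt => 0
  end.
Proof.
have [[_ _ _ fh] fv] := cyl_AP.
case: z => [y|[]] /=; last exact: hg_zero.
  by apply: fh; have [_ h _] := diffP A; apply: h; exact: hg_var.
exact: (hg_var (inr Odt : cyl_gens)).
Qed.

Lemma cyl_diffP : is_derivation 1 cyl_diff.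
Proof. exact: derP cyl_diff_deg. Qed.

Lemma cyl_diff_A a : cyl_diff (cyl_A a) = cyl_A (diff a).
Proof.
have [fm fv] := cyl_AP; apply: der_algmor => //; [exact: diffP|exact: cyl_diffP|].
by move=> y; rewrite fv; exact: (der_var cyl_diff_deg (inl y : cyl_gens)).
Qed.

Lemma cyl_diff_sq a : cyl_diff (cyl_diff a) = 0.
Proof.
have [[lf _ _ _] _] := cyl_AP.
have f0 := lin0 lf.
apply: derivation_sq0 => [|z]; first exact: cyl_diffP.
rewrite [cyl_diff (var z)](der_var cyl_diff_deg).
case: z => [y|[]]; first by rewrite cyl_diff_A diff_sq f0.
  exact: (der_var cyl_diff_deg (inr Odt : cyl_gens)).
exact: der0 cyl_diffP.
Qed.

(* A (x) Omega(1) *)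
Definition Cyl : sdgca := SDgca cyl_diffP cyl_diff_sq.

(* Restriction to t = e. *)
Definition cyl_ev (e : rat) : fgca Cyl -> fgca A :=
  lift (fun z : Cyl =>
    match z with
    | inl y => var y
    | inr Ot => e%:A
    | inr Odt => 0
    end).

End Cyl.

(* (N (x) Omega(1))^+ (x) S(sW), inside Tot N (x) Omega(1) *)
Definition tot_cyl_positive (k : nat) (N : sdgcaW k) : set (fgca (Cyl (Tot N))) :=
  span [set ren (fun z : Cyl N =>
                 match z with
                 | inl y => inl (inl y)
                 | inr o => inr o
                 end : Cyl (Tot N)) a
            * cyl_A (tot_sW N p : fgca (Tot N))
       | a in positive_part (Cyl N) & p in setT].

Arguments tot_cyl_positive {k} N.

(** ** Truncated toroidification *)

Section Trd.
Variables (k : nat) (V : gbasis).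

(* (Q[s_1, ..., s_k] (x) V)^{>0}: the pair (J, v) stands for s_J (x) v, where
   s_J = s_{i_1} ... s_{i_r} for J = {i_1 < ... < i_r}. *)
Definition sdeg (p : {set 'I_k} * V) : int := deg p.2 - #|p.1|%:Z.
Definition strunc := GBasis (fun p : {p | 0 < sdeg p} => sdeg (val p)).
Definition trd_gens := gsum strunc (Wgen k).

(* s_J (x) v as an element of Trd_k(M): zero if its degree is not positive. *)
Definition sgen (J : {set 'I_k}) (v : V) : fgca trd_gens :=
  if insub (J, v) is Some p then var (inl p : trd_gens) else 0.

(* s_i s_J = s_sign i J * s_(J with i added), for i not in J *)
Definition s_sign (i : 'I_k) (J : {set 'I_k}) : rat :=
  (-1) ^+ #|finset (fun j => (j \in J) && (j < i)%N)|.

Definition s_op (i : 'I_k) : fgca trd_gens -> fgca trd_gens :=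
  der (-1) (fun z : trd_gens =>
    match z with
    | inl p =>
        let: (J, v) := val p in
        if i \in J then 0
        else s_sign i J *: sgen (i |: J)%SET v
    | inr _ => 0
    end).

(* The inclusion of S(V), elements of V of degree <= 0 being read as 0. *)
Definition trd_S : fgca V -> fgca trd_gens := lift (sgen finset.set0).

End Trd.


Section TrdTheory.
Variables (k : nat) (V : gbasis).
Implicit Types (J : {set 'I_k}) (v : V).

Lemma sgen_homog J v : homog (deg v - #|J|%:Z) (sgen J v).
Proof.
rewrite /sgen; case: insubP => [p _ E|_]; last exact: hg_zero.
have -> : deg v - #|J|%:Z = deg (inl p : trd_gens k V) by rewrite /= E.
exact: hg_var.
Qed.

Lemma sgen_var (p : strunc k V) :
  var (inl p : trd_gens k V) = sgen (val p).1 (val p).2.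
Proof. by rewrite /sgen -surjective_pairing valK. Qed.

Lemma sgen_drop J v : ~~ (0 < sdeg (J, v)) -> sgen J v = 0.
Proof. by move=> H; rewrite /sgen insubN. Qed.

Lemma s_op_deg (i : 'I_k) (z : trd_gens k V) : homog (deg z + -1)
  match z with
  | inl p => let: (J, v) := val p in
      if i \in J then 0 else s_sign i J *: sgen (i |: J)%SET v
  | inr _ => 0
  end.
Proof.
case: z => [p|j] /=; last exact: hg_zero.
case: (val p) => J v; case: ifPn => [_|iJ]; first exact: hg_zero.
apply: hg_scale; have -> : sdeg (J, v) - 1 = deg v - #|(i |: J)%SET|%:Z.
  by rewrite cardsU1 iJ /sdeg /= add1n -addn1 PoszD opprD addrA.
exact: sgen_homog.
Qed.

Lemma s_opP i : is_derivation (-1) (@s_op k V i).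
Proof. exact: derP (s_op_deg i). Qed.

Lemma s_op_w i j : s_op i (w _ j) = 0 :> fgca (trd_gens k V).
Proof. exact: (der_var (s_op_deg i) (inr j : trd_gens k V)). Qed.

Lemma s_op_sgen i J v : s_op i (sgen J v) =
  if i \in J then 0 else s_sign i J *: sgen (i |: J)%SET v.
Proof.
case: (boolP (0 < sdeg (J, v))) => [H|H].
  rewrite {1}/sgen insubT.
  exact: (der_var (s_op_deg i) (inl (Sub (J, v) H) : trd_gens k V)).
rewrite (sgen_drop H) (der0 (s_opP i)); case: ifPn => // iJ.
rewrite sgen_drop ?scaler0 //; move: H; rewrite /sdeg /= cardsU1 iJ add1n -!leNgt !subr_le0.
by move/le_trans; apply; rewrite lez_nat.
Qed.

Lemma trd_SP : is_algmor (@trd_S k V) /\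
  forall v, trd_S k (var v) = sgen finset.set0 v.
Proof.
apply: lift_algmor => v; have := sgen_homog finset.set0 v.
by rewrite cards0 subr0.
Qed.

Lemma twist_odd X m n : odd `|m| = odd `|n| -> @twist X m = twist n.
Proof.
move=> E; rewrite /twist; congr lift; apply/funext => x.
by rewrite !koszulE E.
Qed.

Lemma anticomm0 X m n (D E : fgca X -> fgca X) : odd `|m| -> odd `|n| ->
  is_derivation m D -> is_derivation n E ->
  (forall x, D (E (var x)) + E (D (var x)) = 0) ->
  forall a, D (E a) + E (D a) = 0.
Proof.
move=> om on HD HE H; elim/fgca_gen_ind => [//|c|a b Ha Hb|a b Ha Hb].
- rewrite !(derZ HE, derZ HD) (der1 HD) (der1 HE).
  by rewrite (der0 HE) (der0 HD) scaler0 addr0.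
- by rewrite !(derD HE, derD HD) addrACA Ha Hb addr0.
have tmn : @twist X m = twist n by apply: twist_odd; rewrite om on.
have twE : @twist X m = twist 1 by apply: twist_odd; rewrite om.
have k1 p : odd `|p| -> koszul 1 p = -1 by move=> op; rewrite koszulE op expr1.
rewrite (derM HE) (derM HD) (derD HD) (derD HE) !(derM HE, derM HD).
rewrite -tmn twE !(der_twist_comm _ _ HD) !(der_twist_comm _ _ HE) !k1 //.
rewrite !scaleN1r !mulNr !twistK.
have -> : E (D a) = - D (E a) by apply/eqP; rewrite -addr_eq0 addrC Ha.
have -> : E (D b) = - D (E b) by apply/eqP; rewrite -addr_eq0 addrC Hb.
rewrite mulNr mulrN; apply/eqP; rewrite addr_eq0 !opprD !opprK; apply/eqP.
by rewrite addrACA.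
Qed.

Lemma s_op_anticomm i j (a : fgca (trd_gens k V)) :
  s_op i (s_op j a) + s_op j (s_op i a) = 0.
Proof.
apply: (anticomm0 _ _ (s_opP i) (s_opP j)) => // -[p|l]; last first.
  by rewrite !s_op_w (der0 (s_opP i)) (der0 (s_opP j)) addr0.
rewrite sgen_var; move: (val p) => [J v] /=; rewrite !s_op_sgen.
case: (boolP (i \in J)) => iJ; case: (boolP (j \in J)) => jJ;
  rewrite ?(der0 (s_opP i)) ?(der0 (s_opP j)) ?(derZ (s_opP i))
    ?(derZ (s_opP j)) ?s_op_sgen ?inE ?iJ ?jJ ?orbT ?scaler0 ?addr0 //.
rewrite (negbTE iJ) (negbTE jJ) !orbF (eq_sym j i).
case: eqVneq => [_|ij]; first by rewrite !scaler0 addr0.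
rewrite !scalerA (_ : j |: (i |: J) = i |: (j |: J))%SET; last by rewrite finset.setUCA.
rewrite -scalerDl.
have E (x y : 'I_k) : x != y -> y \notin J ->
    s_sign x (y |: J)%SET = (-1) ^+ (y < x)%N * s_sign x J.
  move=> xy yJ; rewrite /s_sign -exprD; congr (_ ^+ _).
  case: ltnP => yx.
    rewrite (_ : finset _ = y |: finset (fun l => (l \in J) && (l < x)%N))%SET.
      by rewrite cardsU1 !inE (negbTE yJ).
    by apply/setP => l; rewrite !inE; case: eqVneq => //= ->; rewrite yx.
  congr #|pred_of_set _|; apply/setP => l; rewrite !inE.
  by case: eqVneq => //= ->; rewrite ltnNge yx (negbTE yJ).
rewrite (E i j ij jJ) (E j i _ iJ) 1?eq_sym // !mulrA.
rewrite [s_sign j J * _]mulrC [s_sign i J * _]mulrC -!mulrA.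
rewrite [s_sign j J * _]mulrC -mulrDl.
suff -> : (-1) ^+ (j < i)%N + (-1) ^+ (i < j)%N = 0 :> rat.
  by rewrite mul0r scale0r.
by move: ij; rewrite -val_eqE /=; case: ltngtP.
Qed.

End TrdTheory.
Arguments s_opP {k V}.
Arguments s_op_w {k V}.

(* The clauses that determine the differential of Trd_k(M).  They can be
   contradictory: for k = 1, |v| = 1, |y| = 2 and dv = y, the element s_1 v is
   read as 0 although d_t (s_1 v) should be - s_1 y.  Then Trd_k(M) does not
   exist.  When they are satisfiable, d is unique and its square is 0. *)
Definition is_trd_diff (k : nat) (M : sdgca)
    (d : fgca (trd_gens k M) -> fgca (trd_gens k M)) :=
  [/\ is_derivation 1 d,
      forall v : M, d (trd_S k (var v)) =
        trd_S k (diff (var v)) + \sum_(i < k) w _ i * s_op i (trd_S k (var v)),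
      forall i a, d (s_op i a) + s_op i (d a) = 0 &
      forall i, d (w _ i) = 0].

Section TrdDiff.
Variables (k : nat) (M : sdgca) (d : fgca (trd_gens k M) -> fgca (trd_gens k M)).
Hypothesis Hd : is_trd_diff d.

Let d_der : is_derivation 1 d. Proof. by case: Hd. Qed.
Let d_s i a : d (s_op i a) = - s_op i (d a).
Proof. by case: Hd => _ _ /(_ i a)/eqP; rewrite addr_eq0 => /eqP. Qed.
Let d_w i : d (w _ i) = 0. Proof. by case: Hd. Qed.

Lemma twist_w U n (i : 'I_k) : twist n (w U i) = w U i.
Proof.
rewrite (twist_homog n (hg_var (inr i : gsum U (Wgen k)))).
by rewrite koszulE /= andbF expr0 scale1r.
Qed.

Lemma s_op_wM i j (a : fgca (trd_gens k M)) : s_op i (w _ j * a) = w _ j * s_op i a.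
Proof. by rewrite (derM (s_opP i)) s_op_w mul0r add0r twist_w. Qed.

Lemma trd_diff_S (a : fgca M) :
  d (trd_S k a) = trd_S k (diff a) + \sum_(i < k) w _ i * s_op i (trd_S k a).
Proof.
have [fm fv] := trd_SP k M; have [lf f1 fM _] := fm.
have [_ dv _ _] := Hd.
have Dd := diffP M.
elim/fgca_gen_ind: a => [//|c|a b Ha Hb|a b Ha Hb].
- rewrite (linZ _ _ lf) f1 (derZ d_der) (derZ Dd) (der1 d_der) (der1 Dd).
  rewrite !scaler0 (lin0 lf) add0r big1 // => i _.
  by rewrite (derZ (s_opP i)) (der1 (s_opP i)) scaler0 mulr0.
- rewrite (derD Dd) !(linD _ _ lf) (derD d_der) Ha Hb addrACA -big_split /=.
  congr (_ + _); apply: eq_bigr => i _.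
  by rewrite (derD (s_opP i)) mulrDr.
rewrite (derM Dd) (linD _ _ lf) !fM (derM d_der) Ha Hb.
rewrite (algmor_twist _ _ fm) mulrDl mulrDr addrACA; congr (_ + _).
rewrite mulr_suml mulr_sumr -big_split /=; apply: eq_bigr => i _.
rewrite (derM (s_opP i)) mulrDr !mulrA; congr (_ + _ * _).
rewrite (_ : @twist (trd_gens k M) (-1) = twist 1); last exact: twist_odd.
have Hw := hg_var (inr i : trd_gens k M).
elim: (hsumP (twist 1 (trd_S k a))) => [|m u z Hu _ IH].
  by rewrite mul0r mulr0.
rewrite mulrDl mulrDr IH (homog_gcomm Hw Hu) koszulE /= scale1r.
by [].
Qed.

Lemma trd_diff_sq a : d (d a) = 0.
Proof.
have [fm fv] := trd_SP k M.
apply: derivation_sq0 => // -[p|i]; last by rewrite d_w (der0 d_der).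
rewrite sgen_var; move: (val p) => [J v] /=.
have [n] := ubnP #|J|; elim: n J => // n IH J.
case: (set_0Vmem J) => [->|[i iJ]] Jn.
  have Dd := diffP M; have [lf _ _ _] := fm.
  rewrite -fv trd_diff_S (derD d_der) trd_diff_S diff_sq (lin0 lf) add0r.
  rewrite (der_sum d_der) -big_split /=.
  set A := fun i j => w _ i * (w _ j * s_op i (s_op j (trd_S k (var v)))).
  rewrite (_ : \sum_(i < k) _ = - \sum_(i < k) \sum_(j < k) A i j).
    suff S0 : \sum_(i < k) \sum_(j < k) A i j = - \sum_(i < k) \sum_(j < k) A i j.
      apply/eqP; rewrite oppr_eq0; move/eqP: S0; rewrite -addr_eq0 -mulr2n.
      by rewrite -scaler_nat scaler_eq0.
    rewrite {1}exchange_big /= -sumrN; apply: eq_bigr => i _.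
    rewrite -sumrN; apply: eq_bigr => j _; rewrite /A.
    rewrite !mulrA (homog_gcomm (hg_var (inr j : trd_gens k M))
      (hg_var (inr i : trd_gens k M))) koszulE /= scale1r -mulrN; congr (_ * _).
    by apply/eqP; rewrite -addr_eq0 s_op_anticomm.
  rewrite -sumrN; apply: eq_bigr => i _.
  rewrite (derM d_der) d_w mul0r add0r twist_w d_s trd_diff_S (derD (s_opP i)).
  rewrite opprD mulrDr mulrN addNKr (der_sum (s_opP i)) mulrN; congr (- _).
  by rewrite mulr_sumr; apply: eq_bigr => j _; rewrite s_op_wM.
have E : sgen J v = s_sign i (J :\ i)%SET *: s_op i (sgen (J :\ i)%SET v).
  rewrite s_op_sgen !inE eqxx /= scalerA -expr2 sqrr_sign scale1r.
  by rewrite finset.setD1K.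
rewrite E !(derZ d_der) !d_s (derN d_der) d_s opprK IH ?(der0 (s_opP i)) ?scaler0 //.
by move: Jn; rewrite (cardsD1 i) iJ.
Qed.

Definition Trd : sdgcaW k := SDgcaW d_der trd_diff_sq d_w.

End TrdDiff.

(* The morphism Trd_k(M) -> Trd_k(M') over S(W) that commutes with the s_i and
   restricts to f on V. *)
Definition Trd_map (k : nat) (M M' : sdgca) (f : fgca M -> fgca M') :
    fgca (trd_gens k M) -> fgca (trd_gens k M') :=
  lift (fun z : trd_gens k M =>
    match z with
    | inl p =>
        let: (J, v) := val p in
        foldr (@s_op k M') (trd_S k (f (var v))) (enum J)
    | inr i => w _ i
    end).

(** ** Hom^0, homotopies and homotopy classes *)

Section Homotopy.
Variables (k : nat) (M : sdgca) (N : sdgcaW k).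

Definition dhom0 : set (fgca M -> fgca (Tot N)) :=
  [set f | dhom M (Tot N) f /\ f @` positive_part M `<=` tot_positive N].

Definition homotopic0 (f g : fgca M -> fgca (Tot N)) : Prop :=
  [/\ dhom0 f, dhom0 g &
   exists h : fgca M -> fgca (Cyl (Tot N)),
   [/\ dhom M (Cyl (Tot N)) h,
       h @` positive_part M `<=` tot_cyl_positive N,
       cyl_ev 0 \o h = f & cyl_ev 1 \o h = g]].

Definition homotopicW (T : sdgcaW k) (f g : fgca T -> fgca N) : Prop :=
  [/\ dhomW T N f, dhomW T N g &
   exists h : fgca T -> fgca (Cyl N),
   [/\ dhom T (Cyl N) h,
       forall i, h (w _ i) = cyl_A (w _ i : fgca N),
       cyl_ev 0 \o h = f & cyl_ev 1 \o h = g]].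
End Homotopy.
Arguments dhom0 {k} M N.
Arguments homotopic0 {k} M N.
Arguments homotopicW {k} N T.

(* The classes of H for the equivalence relation generated by R. *)
Definition classes (T : Type) (H : set T) (R : T -> T -> Prop) : set (set T) :=
  [set C | exists2 f, H f & C = [set g | H g /\ clos_refl_sym_trans T R f g]].

(* Main.v *)
Require Import Defs.
From Stdlib Require Import Relation_Operators.
From mathcomp Require Import all_boot all_order all_algebra.
From mathcomp Require Import boolp classical_sets functions.
(* Gives span and lift precedence over their namesakes for vector spaces and
   ordinals. *)
Import Defs.
Set Implicit Arguments.
Unset Strict Implicit.
Unset Printing Implicit Defensive.
Import Order.TTheory GRing.Theory Num.Theory.
Local Open Scope classical_set_scope.
Local Open Scope ring_scope.

(** The totalization Tot N = N (x) S(sW) is an algebra over N in odd variables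
    sw_i, and an element y of it is determined by its Taylor coefficients
    tot_aug (contr i_1 (... (contr i_r y))), where contr i = - d/d(sw_i) and
    tot_aug : Tot N -> N kills every sw_i (taylor_ind, taylor_eq).  The
    contractions behave on Tot N as the operators s_i do on Trd_k(M): they are
    derivations of degree -1 which anticommute with one another and with the
    differential (contr_anticomm, contr_diff).  The augmentation fails to be a
    chain map exactly by the term that twists d_t:
      d (tot_aug y) = tot_aug (d y) + sum_i w_i tot_aug (contr i y)
    (diff_tot_aug).

    Call x in Trd_k(M) and y in Tot N matched by g : Trd_k(M) -> N if g sends
    every s_{i_1} ... s_{i_r} x to the corresponding Taylor coefficient of y.
    Being matched is compatible with all the structure (matchesM,
    matches_diff), and y is unique given x.  A map f : M -> Tot N and a map g
    correspond when f a is matched with the image of a in Trd_k(M) for all a.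
    - Given f, this dictates g on the generators s_J v, hence on Trd_k(M)
      (trd_adjoint).  The words s_J v of degree <= 0 are read as 0 on one side,
      and on the other the positivity condition on f makes the Taylor
      coefficient vanish: it lies in N^+ but has degree <= 0
      (homog_positive_eq0).
    - Given g, the element matched with x is the Taylor series of x
      (taylor_matches); uniqueness makes this series multiplicative in x and
      compatible with the differentials, without any computation of signs.
      It satisfies the positivity condition because Trd_k(M) is generated in
      positive degrees, so that the s_i take values in its positive part
      (s_op_positive), while Tot N contains N^+ (x) S(sW) as the set of
      elements with Taylor coefficients in N^+ (tot_positiveP).

    For homotopies, N (x) Omega(1) is again an algebra over S(W), and
    Tot N (x) Omega(1) is its totalization.  A homotopy on one side is thus an
    element of the corresponding set of maps for N (x) Omega(1), and naturality with
    respect to the evaluations at t = 0 and t = 1 identifies the two homotopy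
    relations. *)

(** * Spans and positive parts *)

Section Span.
Variables (V : lmodType rat) (B : set V).

Lemma span_base b : B b -> span B b.
Proof.
by move=> Bb; rewrite -[b]addr0 -[b]scale1r; apply: span_cons Bb _; exact: span0.
Qed.

Lemma spanD u v : span B u -> span B v -> span B (u + v).
Proof.
move=> Bu Bv; elim: Bu => [|c b u' Bb _ IH]; first by rewrite add0r.
by rewrite -addrA; exact: span_cons.
Qed.

Lemma spanZ c v : span B v -> span B (c *: v).
Proof.
elim=> [|e b u Bb _ IH]; first by rewrite scaler0; exact: span0.
by rewrite scalerDr scalerA; exact: span_cons.
Qed.

Lemma spanN v : span B v -> span B (- v).
Proof. by rewrite -scaleN1r; exact: spanZ. Qed.
End Span.

Lemma span_image (U V : lmodType rat) (B : set U) (C : set V) (f : U -> V) :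
  linear f -> (forall b, B b -> span C (f b)) ->
  forall u, span B u -> span C (f u).
Proof.
move=> lf BC u; elim=> [|c b v Bb _ IH]; first by rewrite (lin0 lf); exact: span0.
by rewrite lf; apply: spanD => //; apply: spanZ; exact: BC.
Qed.

Section LinearFunctions.
Variables (U V : lmodType rat) (f : U -> V).
Hypothesis lf : linear f.

Lemma linN a : f (- a) = - f a.
Proof. by rewrite -scaleN1r (linZ _ _ lf) scaleN1r. Qed.

Lemma linB a b : f (a - b) = f a - f b.
Proof. by rewrite (linD _ _ lf) linN. Qed.

Lemma lin_sum (I : Type) (r : seq I) (F : I -> U) :
  f (\sum_(i <- r) F i) = \sum_(i <- r) f (F i).
Proof.
by elim/big_rec2: _ => [|i a b _ <-]; rewrite ?(lin0 lf) ?(linD _ _ lf).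
Qed.
End LinearFunctions.

Section GradedAlgebra.
Variable X : gbasis.

Lemma mull_linear (a : fgca X) : linear (fun b => a * b).
Proof. by move=> c u v; rewrite mulrDr scalerAr. Qed.

Lemma mulr_linear (a : fgca X) : linear (fun b => b * a).
Proof. by move=> c u v; rewrite mulrDl scalerAl. Qed.

Lemma twist_linear n : linear (@twist X n).
Proof.
move=> c u v; rewrite twistD -[c *: u]mul1r -scalerAr scalerAl twistM twist_cst.
by rewrite -scalerAl mul1r.
Qed.

Lemma der_linear n (D : fgca X -> fgca X) : is_derivation n D -> linear D.
Proof. by case. Qed.

(** The Koszul rule for moving a homogeneous factor past an arbitrary element:
    twist records the sign of each homogeneous component. *)
Lemma mul_homog_twist n (a u : fgca X) : homog n u -> a * u = u * twist n a.
Proof.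
move=> Hu; elim: (hsumP a) => [|m b v Hb _ IH]; first by rewrite twist0 mul0r mulr0.
rewrite twistD mulrDl mulrDr IH (homog_gcomm Hb Hu) (twist_homog _ Hb).
by rewrite koszulC scalerAr.
Qed.

Lemma odd_homog_sq n (u : fgca X) : odd `|n| -> homog n u -> u * u = 0.
Proof.
move=> on Hu; have := homog_gcomm Hu Hu; rewrite koszulE on expr1 scaleN1r => /eqP.
rewrite -addr_eq0 -mulr2n -scaler_nat scaler_eq0 pnatr_eq0 /=.
by move/eqP.
Qed.
End GradedAlgebra.

Lemma algmor_linear X Y (f : fgca X -> fgca Y) : is_algmor f -> linear f.
Proof. by case. Qed.

Lemma algmor_id X : is_algmor (@idfun (fgca X)).
Proof. by []. Qed.

Lemma algmor_comp X Y Z (g : fgca Y -> fgca Z) (f : fgca X -> fgca Y) :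
  is_algmor g -> is_algmor f -> is_algmor (g \o f).
Proof.
case=> lg g1 gM gh [lf f1 fM fh]; split=> [c a b||a b|n a Ha] /=.
- by rewrite lf lg.
- by rewrite f1.
- by rewrite fM gM.
- by apply: gh; exact: fh.
Qed.

Section PositivePart.
Implicit Types A B : sdgca.

Lemma positive_homog A n (a : fgca A) : 0 < n -> homog n a -> positive_part A a.
Proof. by move=> n0 Ha; apply: span_base; exists n. Qed.

Lemma algmor_positive A B (f : fgca A -> fgca B) :
  is_algmor f -> forall a, positive_part A a -> positive_part B (f a).
Proof.
move=> [lf _ _ fh]; apply: span_image => // b [n n0 Hb].
exact: positive_homog n0 (fh _ _ Hb).
Qed.

Lemma twist_positive A m (a : fgca A) :
  positive_part A a -> positive_part A (twist m a).
Proof.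
apply: span_image; first exact: twist_linear.
move=> b [n n0 Hb]; rewrite (twist_homog _ Hb).
by apply: spanZ; exact: positive_homog n0 Hb.
Qed.

Lemma mul_homog_positive A n (a b : fgca A) :
  0 <= n -> homog n a -> positive_part A b ->
  positive_part A (a * b) /\ positive_part A (b * a).
Proof.
move=> n0 Ha Hb; split; move: b Hb.
  apply: span_image; first exact: mull_linear.
  move=> b [m m0 Hb]; apply: (@positive_homog A (n + m)); last exact: hg_mul.
  exact: ltr_wpDl.
apply: span_image; first exact: mulr_linear.
move=> b [m m0 Hb]; apply: (@positive_homog A (m + n)); last exact: hg_mul.
exact: ltr_wpDr.
Qed.

(** Without the hypothesis on the generators, multiplication by an element of
    negative degree leads out of the positive part. *)
Lemma positive_ideal A : positively_generated A ->
  forall a b : fgca A, positive_part A b ->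
  positive_part A (a * b) /\ positive_part A (b * a).
Proof.
move=> HA; elim/fgca_gen_ind => [x|c|a a' IHa IHa'|a a' IHa IHa'] b Hb.
- by apply: mul_homog_positive (hg_var x) Hb; exact: ltW.
- by apply: (@mul_homog_positive _ 0) Hb => //; apply: hg_scale; exact: hg_one.
- have [? ?] := IHa _ Hb; have [? ?] := IHa' _ Hb.
  by rewrite mulrDl mulrDr; split; exact: spanD.
- split; first by rewrite -mulrA; apply: (IHa _ _).1; exact: (IHa' _ Hb).1.
  by rewrite mulrA; apply: (IHa' _ _).2; exact: (IHa _ Hb).2.
Qed.

Lemma derivation_positive A n (D : fgca A -> fgca A) :
  positively_generated A -> is_derivation n D ->
  (forall x, positive_part A (D (var x))) -> forall a, positive_part A (D a).
Proof.
move=> HA HD Dx; elim/fgca_gen_ind => [//|c|a b Ha Hb|a b Ha Hb].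
- by rewrite (derZ HD) (der1 HD) scaler0; exact: span0.
- by rewrite (derD HD); exact: spanD.
- rewrite (derM HD); apply: spanD; first exact: (positive_ideal HA _ Ha).2.
  exact: (positive_ideal HA _ Hb).1.
Qed.

(** The automorphism acting on degree n by 2^n.  Its eigenspaces separate the
    degrees, which shows that components of different degrees are independent. *)
Definition scaling X : fgca X -> fgca X :=
  lift (fun x : X => (2 ^ deg x : rat) *: var x).

Lemma scaling_algmor X : is_algmor (@scaling X) /\
  forall x : X, scaling (var x) = (2 ^ deg x : rat) *: var x.
Proof.
apply: (@lift_algmor X X (fun x : X => (2 ^ deg x : rat) *: var x)) => x.
by apply: hg_scale; exact: hg_var.
Qed.

Lemma scaling_linear X : linear (@scaling X).
Proof. by case: (scaling_algmor X) => -[]. Qed.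

Lemma scaling_homog X n (a : fgca X) : homog n a -> scaling a = (2 ^ n : rat) *: a.
Proof.
have [fm fv] := scaling_algmor X.
have [lf f1 fM _] := fm.
elim=> {n a} [x||n|n a b _ IHa _ IHb|n c a _ IHa|m n a b _ IHa _ IHb].
- exact: fv.
- by rewrite f1 expr0z scale1r.
- by rewrite (lin0 lf) scaler0.
- by rewrite (linD _ _ lf) IHa IHb scalerDr.
- by rewrite (linZ _ _ lf) IHa !scalerA mulrC.
- rewrite fM IHa IHb -scalerAl -scalerAr scalerA -expfzDr //.
Qed.

(** The element is an eigenvector of scaling for the eigenvalue 2^n, and it is
    killed by a product of operators scaling - 2^m with m > 0.  On the former
    this product acts as a nonzero scalar, since n <= 0. *)
Lemma homog_positive_eq0 A n (a : fgca A) :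
  n <= 0 -> homog n a -> positive_part A a -> a = 0.
Proof.
move=> n0 Ha Pa.
pose op (b : fgca A) (m : int) := scaling b - (2 ^ m : rat) *: b.
have lop m : linear (op^~ m).
  move=> c u v; rewrite /op scaling_linear scalerBr scalerDr !scalerA.
  by rewrite [2 ^ m * c]mulrC opprD addrACA.
have opC m p b : op (op b m) p = op (op b p) m.
  have opS : op (scaling b) p = scaling (op b p).
    by rewrite /op (linB (@scaling_linear A)) (linZ _ _ (@scaling_linear A)).
  transitivity (op (scaling b) p - 2 ^ m *: op b p); last by rewrite opS.
  by rewrite -(linZ _ _ (lop p)) -(linB (lop p)).
have opsC m ms b : foldl op (op b m) ms = op (foldl op b ms) m.
  by elim: ms b => //= p ms IH b; rewrite opC IH.
have lops ms : linear (fun b => foldl op b ms).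
  by elim: ms => [|m ms IH] c u v //=; rewrite lop IH.
have [ms ms0 Ea] : exists2 ms : seq int, all (fun m => 0 < m) ms & foldl op a ms = 0.
  elim: Pa => [|c b v [m m0 Hb] _ [ms ms0 IH]].
    by exists [::] => //; rewrite (lin0 (lops [::])).
  exists (m :: ms); first by rewrite /= m0.
  rewrite /= lop lops !opsC IH (lin0 (lop m)) addr0 -opsC.
  by rewrite /op (scaling_homog Hb) subrr (lin0 (lops ms)) scaler0.
have {Ea} : (\prod_(m <- ms) (2 ^ n - 2 ^ m : rat)) *: a = 0.
  rewrite -Ea {Ea}; elim: ms ms0 => [|m ms IH] /=; first by rewrite big_nil scale1r.
  case/andP=> _ ms0; rewrite opsC -(IH ms0) big_cons /op (linZ _ _ (@scaling_linear A)).
  by rewrite (scaling_homog Ha) !scalerA -scalerBl mulrC mulrBr [2 ^ m * _]mulrC.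
move/eqP; rewrite scaler_eq0 => /orP[|/eqP //].
rewrite prodf_seq_eq0 => /hasP[m /(allP ms0) m0 /=].
rewrite subr_eq0 => /eqP nm0.
have nm : n = m by apply: (@ieexprIz rat 2) nm0.
by move: m0; rewrite -nm ltNge n0.
Qed.
End PositivePart.

(** * Words in anticommuting operators *)

Section Anticommuting.
Variable I : eqType.

Definition anticommuting (V : lmodType rat) (A : I -> V -> V) :=
  (forall i, linear (A i)) /\ forall i j x, A i (A j x) + A j (A i x) = 0.

Section Words.
Variables (V : lmodType rat) (A : I -> V -> V) (HA : anticommuting A).
Let lA i : linear (A i) := HA.1 i.

Lemma anticommN i j x : A i (A j x) = - A j (A i x).
Proof. by apply/eqP; rewrite -addr_eq0 HA.2. Qed.

Lemma anticomm_sq i x : A i (A i x) = 0.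
Proof.
have /eqP := HA.2 i i x.
by rewrite -mulr2n -scaler_nat scaler_eq0 pnatr_eq0 /= => /eqP.
Qed.

Lemma foldr_anticomm_linear l : linear (fun x => foldr A x l).
Proof. by elim: l => [|i l IH] c u v //=; rewrite IH lA. Qed.

(** Words in anticommuting operators behave as monomials in an exterior algebra:
    reordering costs a sign and repetitions vanish. *)
Lemma foldr_anticomm_move l1 i l2 x :
  foldr A x (l1 ++ i :: l2) = (-1) ^+ size l1 *: A i (foldr A x (l1 ++ l2)).
Proof.
elim: l1 => [|j l1 IH] /=; first by rewrite scale1r.
by rewrite IH (linZ _ _ (lA j)) anticommN exprS -scalerA scaleN1r scalerN.
Qed.
End Words.

(** The scalar is quantified before the operators, so that the same reordering
    can be applied to the s_i and to the contractions. *)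
Lemma foldr_anticomm_perm (l l' : seq I) : perm_eq l l' ->
  exists c : rat, forall (V : lmodType rat) (A : I -> V -> V),
    anticommuting A -> forall x, foldr A x l = c *: foldr A x l'.
Proof.
elim: l l' => [|i l IH] l' ll'.
  move: ll'; rewrite perm_sym => /perm_nilP->.
  by exists 1 => V A HA x; rewrite scale1r.
have il' : i \in l' by rewrite -(perm_mem ll') mem_head.
case/splitPr: il' ll' => l1 l2.
rewrite perm_sym -cat1s perm_catCA perm_cons perm_sym => /IH[c Hc].
exists (c * (-1) ^+ size l1) => V A HA x.
rewrite (foldr_anticomm_move HA) scalerA -mulrA -exprD -signr_odd oddD addbb mulr1.
by rewrite /= (Hc V A HA) (linZ _ _ (HA.1 i)).
Qed.
End Anticommuting.

(** Every word equals, up to a scalar that depends on the word alone, the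
    increasing word on a subset.  This reduces statements about all words to the
    generators s_J v of the toroidification. *)
Lemma foldr_anticomm_enum k (l : seq 'I_k) :
  exists (c : rat) (J : {set 'I_k}), forall (V : lmodType rat) (A : 'I_k -> V -> V),
    anticommuting A -> forall x, foldr A x l = c *: foldr A x (enum J).
Proof.
elim: l => [|i l [c [J IH]]].
  by exists 1, finset.set0 => V A HA x; rewrite enum_set0 scale1r.
have [iJ|iJ] := boolP (i \in J).
  have := perm_to_rem (_ : i \in enum J); rewrite mem_enum => /(_ iJ).
  case/foldr_anticomm_perm=> c' Hc'; exists 0, J => V A HA x /=.
  rewrite (IH V A HA) (Hc' V A HA) /= !(linZ _ _ (HA.1 i)) (anticomm_sq HA).
  by rewrite !scaler0 scale0r.
have : perm_eq (i :: enum J) (enum (i |: J)%SET).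
  apply: uniq_perm => [||j]; rewrite /= ?enum_uniq ?mem_enum ?iJ //.
  by rewrite inE !mem_enum !inE.
case/foldr_anticomm_perm=> c' Hc'; exists (c * c'), (i |: J)%SET => V A HA x /=.
by rewrite (IH V A HA) (linZ _ _ (HA.1 i)) -scalerA -(Hc' V A HA).
Qed.

(** * Contractions on the totalization *)

Section Contraction.
Variables (k : nat) (N : sdgcaW k).
Implicit Types (i j : 'I_k) (x y : fgca (Tot N)) (a : fgca N).

Definition sw i : fgca (Tot N) := var (inr i : Tot N).

Lemma sw_homog i : homog 1 (sw i).
Proof. exact: (hg_var (inr i : Tot N)). Qed.

Lemma sw_sq i : sw i * sw i = 0.
Proof. exact: odd_homog_sq (sw_homog i). Qed.

Lemma tot_NP : is_algmor (@tot_N k N) /\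
  forall z, tot_N (var z) = var (inl z : Tot N).
Proof. exact: algmor_ren. Qed.

Lemma tot_sWP : is_algmor (@tot_sW k N) /\
  forall i : sWgen k, tot_sW N (var i) = sw i.
Proof. exact: (@algmor_ren (sWgen k) (tot_gens N) inr). Qed.

(** Killing the variables sw_i one at a time interpolates between the identity and
    tot_N o tot_aug. *)
Definition tot_kill (P : pred 'I_k) : fgca (Tot N) -> fgca (Tot N) :=
  lift (fun z : Tot N =>
    match z with inl y => var (inl y : Tot N) | inr i => if P i then 0 else sw i end).

Lemma tot_killP P : is_algmor (tot_kill P) /\
  forall z, tot_kill P (var z) =
    match z with inl y => var (inl y : Tot N) | inr i => if P i then 0 else sw i end.
Proof.
apply: (@lift_algmor (Tot N) (Tot N)) => -[z|i].
  exact: (hg_var (inl z : Tot N)).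
by case: ifP => _; [exact: hg_zero | exact: sw_homog].
Qed.

Definition tot_aug : fgca (Tot N) -> fgca N :=
  lift (fun z : Tot N => match z with inl y => var y | inr _ => 0 end).

Lemma tot_augP : is_algmor tot_aug /\
  forall z : Tot N, tot_aug (var z) = match z with inl y => var y | inr _ => 0 end.
Proof.
apply: (@lift_algmor (Tot N) N) => -[z|i]; first exact: hg_var.
exact: hg_zero.
Qed.

Lemma tot_aug_N a : tot_aug (tot_N a) = a.
Proof.
have [fm fv] := tot_augP; have [gm gv] := tot_NP.
rewrite -[LHS]/((tot_aug \o @tot_N k N) a).
by rewrite (algmor_eq (algmor_comp fm gm) (@algmor_id _)) // => z; rewrite /= gv fv.
Qed.

Lemma tot_kill_all : tot_kill xpredT = @tot_N k N \o tot_aug.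
Proof.
have [fm fv] := tot_augP; have [gm gv] := tot_NP; have [hm hv] := tot_killP xpredT.
apply: algmor_eq hm (algmor_comp gm fm) _ => z; rewrite /= fv hv.
by case: z => [z|i]; rewrite ?gv ?(lin0 (algmor_linear gm)).
Qed.

(** The sign makes contr i correspond to s_i: with d/d(sw_i) the correction term
    of diff_tot_aug would have the sign opposite to that in d_t. *)
Definition contr i : fgca (Tot N) -> fgca (Tot N) :=
  der (-1) (fun z : Tot N =>
    match z with inl _ => 0 | inr j => if j == i then -1 else 0 end).

Lemma contrP i : is_derivation (-1) (contr i) /\
  forall z, contr i (var z) =
    match z with inl _ => 0 | inr j => if j == i then -1 else 0 end.
Proof.
have H (z : Tot N) : homog (deg z + -1)
    (match z with inl _ => 0 | inr j => if j == i then -1 else 0 end : fgca (Tot N)).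
  case: z => [z|j] /=; first exact: hg_zero.
  by case: ifP => _; [rewrite -scaleN1r; apply: hg_scale; exact: hg_one|exact: hg_zero].
by split; [exact: derP H | exact: (der_var H)].
Qed.

Lemma contrM i x y : contr i (x * y) = contr i x * y + twist 1 x * contr i y.
Proof.
by rewrite (derM (contrP i).1) (_ : @twist (Tot N) (-1) = twist 1) //; exact: twist_odd.
Qed.

Lemma contr_linear i : linear (contr i).
Proof. exact: der_linear (contrP i).1. Qed.

Lemma contr_N i a : contr i (tot_N a) = 0.
Proof.
have [cd cv] := contrP i; have [[lf f1 fM _] gv] := tot_NP.
elim/fgca_gen_ind: a => [z|c|a b Ha Hb|a b Ha Hb].
- by rewrite gv cv.
- by rewrite (linZ _ _ lf) f1 (derZ cd) (der1 cd) scaler0.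
- by rewrite (linD _ _ lf) (derD cd) Ha Hb addr0.
- by rewrite fM contrM Ha Hb mul0r mulr0 addr0.
Qed.

Lemma contr_sw i j x :
  contr i (sw j * x) = (if j == i then - x else 0) - sw j * contr i x.
Proof.
rewrite contrM (contrP i).2 (twist_homog _ (sw_homog j)) koszulE /= expr1 scaleN1r.
by rewrite mulNr; case: ifP; rewrite ?mulN1r ?mul0r.
Qed.

Lemma contr_anticomm : anticommuting contr.
Proof.
split=> [i|i j x]; first exact: contr_linear.
apply: (anticomm0 _ _ (contrP i).1 (contrP j).1) => // z.
rewrite !(contrP _).2; case: z => [z|l].
  by rewrite (der0 (contrP i).1) (der0 (contrP j).1) addr0.
by do 2!case: ifP => _;
  rewrite ?(derN (contrP _).1) ?(der1 (contrP _).1) ?(der0 (contrP _).1) ?oppr0 addr0.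
Qed.

(** The bracket of contr i and the differential is a derivation that sends sw_j
    to contr i w_j = 0 and vanishes on N. *)
Lemma contr_diff i x : contr i (diff x) = - diff (contr i x).
Proof.
apply/eqP; rewrite -addr_eq0; apply/eqP.
apply: (anticomm0 _ _ (contrP i).1 (diffP (Tot N))) => // z.
have -> : diff (var z) = tot_N (match z with inl y => diff (var y) | inr j => w _ j end)
    :> fgca (Tot N).
  by rewrite [LHS](der_var (@tot_diff_deg k N)); case: z.
rewrite contr_N (contrP i).2 add0r; case: z => [z|j].
  exact: (der0 (diffP (Tot N))).
by case: ifP => _; rewrite ?(derN (diffP (Tot N))) ?(der1 (diffP (Tot N)))
  ?(der0 (diffP (Tot N))) ?oppr0.
Qed.

Lemma tot_aug_twist n x : tot_aug (twist n x) = twist n (tot_aug x).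
Proof. exact: algmor_twist tot_augP.1. Qed.

(** Both sides are derivations along tot_aug, so generators suffice; on sw_j the
    left side is 0 and the two terms on the right are w_j and - w_j. *)
Lemma diff_tot_aug x :
  diff (tot_aug x) = tot_aug (diff x) + \sum_(i < k) w _ i * tot_aug (contr i x).
Proof.
have [[lf f1 fM fh] fv] := tot_augP.
have dT := diffP (Tot N); have dN := diffP N.
elim/fgca_gen_ind: x => [z|c|x y Hx Hy|x y Hx Hy].
- have -> : diff (var z) = tot_N (match z with inl y => diff (var y) | inr j => w _ j end)
      :> fgca (Tot N).
    by rewrite [LHS](der_var (@tot_diff_deg k N)); case: z.
  rewrite tot_aug_N fv; case: z => [z|j].
    rewrite big1 ?addr0 // => i _.
    by rewrite (contrP i).2 (lin0 lf) mulr0.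
  rewrite (der0 dN) (bigD1 j) //= (contrP j).2 eqxx (linN lf) f1 mulrN1.
  rewrite big1 ?addr0 ?subrr // => i ij.
  by rewrite (contrP i).2 eq_sym (negbTE ij) (lin0 lf) mulr0.
- rewrite (derZ dT) (der1 dT) scaler0 (lin0 lf) (linZ _ _ lf) f1 (derZ dN) (der1 dN).
  rewrite scaler0 big1 ?addr0 // => i _.
  by rewrite (derZ (contrP i).1) (der1 (contrP i).1) scaler0 (lin0 lf) mulr0.
- rewrite (linD _ _ lf) (derD dN) Hx Hy (derD dT) (linD _ _ lf) addrACA; congr (_ + _).
  rewrite -big_split /=; apply: eq_bigr => i _.
  by rewrite (derD (contrP i).1) (linD _ _ lf) mulrDr.
rewrite fM (derM dN) Hx Hy (derM dT) (linD _ _ lf) !fM tot_aug_twist.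
rewrite mulrDl mulrDr addrACA; congr (_ + _).
rewrite mulr_suml mulr_sumr -big_split /=; apply: eq_bigr => i _.
rewrite contrM (linD _ _ lf) !fM tot_aug_twist mulrDr !mulrA; congr (_ + _ * _).
rewrite (mul_homog_twist _ (hg_var (inr i : N))); congr (_ * _).
elim: (hsumP (twist 1 (tot_aug x))) => [|m u v Hu _ IH]; first by rewrite twist0.
by rewrite twistD IH (twist_homog _ Hu) koszulE /= scale1r.
Qed.

(** First-order Taylor expansion in the single odd variable sw_i: no higher terms
    occur as sw_i squares to 0. *)
Lemma tot_kill_step (P Q : pred 'I_k) i x :
  ~~ Q i -> (forall j, P j = Q j || (j == i)) ->
  tot_kill Q x = tot_kill P x - sw i * tot_kill P (contr i x).
Proof.
move=> Qi PQ; have [fm fv] := tot_killP Q; have [gm gv] := tot_killP P.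
have [lf f1 fM _] := fm; have [lg g1 gM _] := gm.
elim/fgca_gen_ind: x => [z|c|x y Hx Hy|x y Hx Hy].
- rewrite fv gv (contrP i).2; case: z => [z|j].
    by rewrite (lin0 lg) mulr0 subr0.
  rewrite PQ; case: eqVneq => [->|ji].
    by rewrite (negbTE Qi) orbT (linN lg) g1 mulrN1 opprK add0r.
  by rewrite orbF (lin0 lg) mulr0 subr0.
- rewrite (derZ (contrP i).1) (der1 (contrP i).1) scaler0 (lin0 lg) mulr0 subr0.
  by rewrite (linZ _ _ lf) (linZ _ _ lg) f1 g1.
- rewrite (linD _ _ lf) (derD (contrP i).1) !(linD _ _ lg) Hx Hy.
  by rewrite mulrDr opprD addrACA.
rewrite fM Hx Hy contrM (linD _ _ lg) !gM (algmor_twist _ _ gm).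
have sw_l u v : u * (sw i * v) = sw i * (twist 1 u * v).
  by rewrite mulrA (mul_homog_twist _ (sw_homog i)) -mulrA.
have sw0 u v : sw i * u * (sw i * v) = 0.
  by rewrite -mulrA sw_l mulrA sw_sq mul0r.
by rewrite mulrBl !mulrBr sw_l sw0 subr0 mulrDr opprD addrA [RHS]addrAC !mulrA.
Qed.

(** Iterated expansion: y is recovered from its Taylor coefficients by subtracting
    multiples of the sw_i.  Taking T = {0} gives uniqueness, and taking T to be
    N^+ (x) S(sW) gives a criterion for membership. *)
Lemma taylor_ind (T : set (fgca (Tot N))) x :
  (forall i y z, T y -> T z -> T (y - sw i * z)) ->
  (forall l, T (tot_N (tot_aug (foldr contr x l)))) -> T x.
Proof.
move=> TB Tx.
suff H (L : seq 'I_k) : uniq L -> forall l,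
    T (tot_kill (fun j => j \notin L) (foldr contr x l)).
  have := H _ (enum_uniq 'I_k) [::].
  have [fm fv] := tot_killP (fun j => j \notin enum 'I_k).
  rewrite (algmor_eq fm (@algmor_id _)) // => z; rewrite fv.
  by case: z => // i; rewrite mem_enum.
elim: L => [|i L IH] /=.
  move=> _ l; have := Tx l.
  by rewrite -[tot_N _]/((@tot_N k N \o tot_aug) _) -tot_kill_all.
case/andP=> iL uL l; rewrite (@tot_kill_step (fun j => j \notin L) _ i).
- by apply: TB; [exact: IH | exact: (IH uL (i :: l))].
- by rewrite mem_head.
- by move=> j; rewrite inE negb_or; case: eqVneq => [->|_]; rewrite ?orbT ?orbF //= iL.
Qed.

Lemma taylor_eq x y :
  (forall l, tot_aug (foldr contr x l) = tot_aug (foldr contr y l)) -> x = y.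
Proof.
move=> xy; apply/eqP; rewrite -subr_eq0; apply/eqP.
apply: (taylor_ind (T := [set 0])) => [i u v -> ->|l] /=; first by rewrite mulr0 subr0.
rewrite (linB (foldr_anticomm_linear contr_anticomm l)) (linB (algmor_linear tot_augP.1)).
by rewrite xy subrr (lin0 (algmor_linear tot_NP.1)).
Qed.

Lemma contr_homog n x l : homog n x -> homog (n - (size l)%:Z) (foldr contr x l).
Proof.
move=> Hx; elim: l => [|i l IH] /=; first by rewrite subr0.
have [[_ h _] _] := contrP i.
by rewrite -addn1 PoszD opprD addrA; exact: h.
Qed.

Lemma contr_tot_sW i (p : fgca (sWgen k)) :
  exists p', contr i (tot_sW N p) = tot_sW N p'.
Proof.
have [[lf f1 fM _] fv] := tot_sWP.
elim/fgca_gen_ind: p => [z|c|x y [x' Hx] [y' Hy]|x y [x' Hx] [y' Hy]].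
- rewrite fv (contrP i).2; case: ifP => _; last by exists 0; rewrite (lin0 lf).
  by exists (-1); rewrite (linN lf) f1.
- exists 0.
  by rewrite (linZ _ _ lf) f1 (derZ (contrP i).1) (der1 (contrP i).1) scaler0 (lin0 lf).
- by exists (x' + y'); rewrite !(linD _ _ lf) (derD (contrP i).1) Hx Hy.
exists (x' * y + twist 1 x * y').
by rewrite (linD _ _ lf) !fM contrM Hx Hy (algmor_twist _ _ tot_sWP.1).
Qed.

Lemma tot_positive_contr i x : tot_positive N x -> tot_positive N (contr i x).
Proof.
apply: span_image => [|_ [a Ha [p _ <-]]]; first exact: contr_linear.
rewrite contrM contr_N mul0r add0r -(algmor_twist _ _ tot_NP.1).
have [p' ->] := contr_tot_sW i p; apply: span_base.
by exists (twist 1 a); [exact: twist_positive | exists p'].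
Qed.

Lemma tot_aug_tot_sW (p : fgca (sWgen k)) :
  exists c : rat, tot_aug (tot_sW N p) = c%:A.
Proof.
have [[lf f1 fM _] fv] := tot_sWP; have [[lg g1 gM _] gv] := tot_augP.
elim/fgca_gen_ind: p => [z|c|x y [c Hx] [e Hy]|x y [c Hx] [e Hy]].
- by exists 0; rewrite fv gv scale0r.
- by exists c; rewrite (linZ _ _ lf) f1 (linZ _ _ lg) g1.
- by exists (c + e); rewrite (linD _ _ lf) (linD _ _ lg) Hx Hy scalerDl.
- by exists (c * e); rewrite fM gM Hx Hy -scalerAl mul1r scalerA.
Qed.

Lemma tot_positive_aug x : tot_positive N x -> positive_part N (tot_aug x).
Proof.
apply: span_image => [|_ [a Ha [p _ <-]]]; first exact: (algmor_linear tot_augP.1).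
have [_ _ gM _] := tot_augP.1; rewrite gM tot_aug_N.
have [c ->] := tot_aug_tot_sW p; rewrite -scalerAr mulr1.
exact: spanZ.
Qed.

Lemma tot_positiveP x : tot_positive N x <->
  forall l, positive_part N (tot_aug (foldr contr x l)).
Proof.
split=> [Hx l|Hx].
  apply: tot_positive_aug; elim: l => //= i l; exact: tot_positive_contr.
apply: taylor_ind => [i y z Hy Hz|l].
  apply: spanD => //; apply: spanN; move: z Hz.
  apply: span_image => [|_ [a Ha [p _ <-]]]; first exact: mull_linear.
  apply: span_base; exists (twist 1 a); first exact: twist_positive.
  exists (var (i : sWgen k) * p) => //; have [_ _ pM _] := tot_sWP.1.
  rewrite pM tot_sWP.2 !mulrA (algmor_twist _ _ tot_NP.1).
  by rewrite (mul_homog_twist _ (sw_homog i)) twistK.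
apply: span_base; exists (tot_aug (foldr contr x l)) => //.
by exists 1 => //; have [_ -> _ _] := tot_sWP.1; rewrite mulr1.
Qed.

End Contraction.

(** * The correspondence between maps out of M and out of its toroidification *)

Section TruncatedWords.
Variables (k : nat) (V : gbasis).
Implicit Types (J : {set 'I_k}) (v : V).

Lemma s_op_anticommuting : anticommuting (@s_op k V).
Proof.
split; last exact: s_op_anticomm.
by move=> i; exact: der_linear (s_opP i).
Qed.

Lemma enum_ord_sorted J : sorted (fun i j : 'I_k => (i < j)%N) (enum J).
Proof.
rewrite {1}/enum_mem; apply: sorted_filter; first by move=> ? ? ?; exact: ltn_trans.
rewrite -enumT; have := iota_ltn_sorted 0 k.
by rewrite -val_enum_ord sorted_map.
Qed.

(** The increasing word incurs no sign, because each s_i is applied to a word in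
    larger indices. *)
Lemma foldr_s_op_sgen J v : foldr (@s_op k V) (sgen finset.set0 v) (enum J) = sgen J v.
Proof.
have -> : J = [set:: enum J]%SET by apply/setP => i; rewrite !inE mem_enum.
have := enum_ord_sorted J; rewrite [enum [set:: _]%SET](_ : _ = enum J); last first.
  by apply: eq_enum => i; rewrite !inE mem_enum.
elim: (enum J) => [|i l IH] /=.
  by move=> _; congr sgen; apply/setP => i; rewrite !inE.
rewrite path_sortedE; last by move=> ? ? ?; exact: ltn_trans.
case/andP=> /allP il sl; rewrite IH // s_op_sgen inE.
case: ifP => [/il|_]; first by rewrite ltnn.
rewrite finset.set_cons /s_sign (_ : finset _ = finset.set0) ?cards0 ?scale1r //.
apply/setP => j; rewrite !inE; apply/negP => /andP[/il ij ji].
by have := ltn_trans ij ji; rewrite ltnn.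
Qed.
End TruncatedWords.

Section Matching.
Variables (k : nat) (V : gbasis) (N : sdgcaW k).
Implicit Types (x : fgca (trd_gens k V)) (y : fgca (Tot N)).

Definition matches (g : fgca (trd_gens k V) -> fgca N) x y :=
  forall l, g (foldr (@s_op k V) x l) = tot_aug (foldr (@contr k N) y l).

Section Closure.
Variables (g : fgca (trd_gens k V) -> fgca N) (gm : is_algmor g).

Let lg : linear g := algmor_linear gm.
Let la : linear (@tot_aug k N) := algmor_linear (tot_augP N).1.
Let ls l : linear (fun x => foldr (@s_op k V) x l) :=
  foldr_anticomm_linear (@s_op_anticommuting k V) l.
Let lc l : linear (fun y => foldr (@contr k N) y l) :=
  foldr_anticomm_linear (@contr_anticomm k N) l.

Lemma matchesD x y x' y' :
  matches g x y -> matches g x' y' -> matches g (x + x') (y + y').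
Proof.
by move=> H H' l; rewrite (linD _ _ (ls l)) (linD _ _ (lc l)) (linD _ _ lg) H H' -(linD _ _ la).
Qed.

Lemma matchesZ c x y : matches g x y -> matches g (c *: x) (c *: y).
Proof.
by move=> H l; rewrite (linZ _ _ (ls l)) (linZ _ _ (lc l)) (linZ _ _ lg) H -(linZ _ _ la).
Qed.

Lemma matchesN x y : matches g x y -> matches g (- x) (- y).
Proof. by rewrite -!scaleN1r; exact: matchesZ. Qed.

Lemma matches_s i x y : matches g x y -> matches g (s_op i x) (contr i y).
Proof. by move=> H l; rewrite -!foldr_rcons. Qed.

Lemma matches_const : matches g 1 1.
Proof.
have [_ g1 _ _] := gm; have [_ a1 _ _] := (tot_augP N).1.
elim/last_ind=> [|l i _]; first by rewrite /= g1 a1.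
rewrite !foldr_rcons (der1 (s_opP i)) (der1 (contrP N i).1).
by rewrite (lin0 (ls l)) (lin0 (lc l)) (lin0 lg) (lin0 la).
Qed.

Lemma matches_twist x y : matches g x y -> matches g (twist 1 x) (twist 1 y).
Proof.
have tw_foldr U (D : 'I_k -> fgca U -> fgca U) (u : fgca U) l :
    (forall i, is_derivation (-1) (D i)) ->
    foldr D (twist 1 u) l = (-1) ^+ size l *: twist 1 (foldr D u l).
  move=> HD; elim: l => [|i l IH] /=; first by rewrite scale1r.
  rewrite IH (derZ (HD i)) (der_twist_comm _ _ (HD i)) scalerA exprS mulrC.
  by rewrite koszulE.
move=> H l; rewrite (tw_foldr _ (@s_op k V)); last by move=> i; exact: s_opP.
rewrite (tw_foldr _ (@contr k N)); last by move=> i; exact: (contrP N i).1.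
rewrite (linZ _ _ lg) (linZ _ _ la) (algmor_twist _ _ gm) H.
by rewrite (tot_aug_twist 1).
Qed.

(** s_i and contr i obey the same Leibniz rule, so the products expand in the same
    way.  The induction peels off the innermost operator. *)
Lemma matchesM x y x' y' :
  matches g x y -> matches g x' y' -> matches g (x * x') (y * y').
Proof.
move=> H H' l; elim/last_ind: l x y x' y' H H' => [|l i IH] x y x' y' H H'.
  have [_ _ gM _] := gm; have [_ _ aM _] := (tot_augP N).1.
  by rewrite /= gM aM (H [::]) (H' [::]).
rewrite !foldr_rcons (derM (s_opP i)) contrM.
rewrite (_ : @twist (trd_gens k V) (-1) = twist 1); last exact: twist_odd.
rewrite (linD _ _ (ls l)) (linD _ _ (lc l)) (linD _ _ lg) (linD _ _ la).
by congr (_ + _); apply: IH => //; [exact: matches_s | exact: matches_twist | exact: matches_s].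
Qed.
End Closure.

Lemma matches_inj g x y y' : matches g x y -> matches g x y' -> y = y'.
Proof. by move=> H H'; apply: taylor_eq => l; rewrite -H -H'. Qed.

Lemma matches_algmor g (U : gbasis) (h : fgca U -> fgca (trd_gens k V))
    (f : fgca U -> fgca (Tot N)) :
  is_algmor g -> is_algmor h -> is_algmor f ->
  (forall u, matches g (h (var u)) (f (var u))) -> forall a, matches g (h a) (f a).
Proof.
move=> gm [lh h1 hM _] [lf f1 fM _] H.
elim/fgca_gen_ind => [//|c|a b Ha Hb|a b Ha Hb].
- rewrite (linZ _ _ lh) (linZ _ _ lf) h1 f1; apply: matchesZ => //.
  exact: matches_const.
- by rewrite (linD _ _ lh) (linD _ _ lf); exact: matchesD.
- by rewrite hM fM; exact: matchesM.
Qed.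

Definition trd_adjoint (f : fgca V -> fgca (Tot N)) : fgca (trd_gens k V) -> fgca N :=
  lift (fun z : trd_gens k V =>
    match z with
    | inl p =>
        let: (J, v) := val p in
        tot_aug (foldr (@contr k N) (f (var v)) (enum J))
    | inr i => w _ i
    end).

Lemma trd_adjointP f : is_algmor f -> is_algmor (trd_adjoint f) /\
  forall z : trd_gens k V, trd_adjoint f (var z) =
    match z with
    | inl p =>
        let: (J, v) := val p in
        tot_aug (foldr (@contr k N) (f (var v)) (enum J))
    | inr i => w _ i
    end.
Proof.
case=> _ _ _ fh; apply: (@lift_algmor (trd_gens k V) N) => -[p|i]; last first.
  exact: (hg_var (inr i : N)).
have [_ _ _ ah] := (tot_augP N).1.
rewrite /= /sdeg; case: (val p) => J v /=; apply: ah.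
by rewrite cardE; apply: contr_homog; apply: fh; exact: hg_var.
Qed.
End Matching.

Section Adjunction.
Variables (k : nat) (M : sdgca) (N : sdgcaW k).
Hypothesis HM : positively_generated M.

Lemma trd_S_var (v : M) : trd_S k (var v) = sgen finset.set0 v.
Proof. exact: (trd_SP k M).2. Qed.

(** ** From maps into the totalization to maps out of the toroidification *)

Section Adjoint.
Variables (f : fgca M -> fgca (Tot N)) (fm : is_algmor f).
Hypothesis fpos : f @` positive_part M `<=` tot_positive N.

(** By definition this holds for the generators; for a pair of degree <= 0 the
    left side is 0, and the right side vanishes as an element of N^+ of degree
    <= 0. *)
Lemma trd_adjoint_sgen J v :
  trd_adjoint f (sgen J v) = tot_aug (foldr (@contr k N) (f (var v)) (enum J)).
Proof.
have [gm gv] := trd_adjointP fm.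
have [J0|J0] := boolP (0 < sdeg (J, v)).
  by rewrite {1}/sgen insubT gv.
rewrite sgen_drop // (lin0 (algmor_linear gm)); apply/esym.
have [_ _ _ fh] := fm; have [_ _ _ ah] := (tot_augP N).1.
apply: (@homog_positive_eq0 N (deg v - (size (enum J))%:Z)).
- by rewrite -cardE leNgt.
- by apply: ah; apply: contr_homog; apply: fh; exact: hg_var.
- apply: (tot_positiveP _).1; apply: fpos; exists (var v) => //.
  exact: positive_homog (HM v) (hg_var v).
Qed.

(** For a generator v, the words in the s_i and in the contractions are reduced
    simultaneously to increasing ones. *)
Lemma trd_adjoint_matches a : matches (trd_adjoint f) (trd_S k a) (f a).
Proof.
have [gm _] := trd_adjointP fm.
apply: (matches_algmor gm (trd_SP k M).1 fm) => v l.
have [c [J E]] := foldr_anticomm_enum l.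
rewrite (E _ _ (@s_op_anticommuting k M)) (E _ _ (@contr_anticomm k N)) trd_S_var.
rewrite foldr_s_op_sgen (linZ _ _ (algmor_linear gm)) trd_adjoint_sgen.
by rewrite (linZ _ _ (algmor_linear (tot_augP N).1)).
Qed.
End Adjoint.

Lemma trd_adjoint_inj (f f' : fgca M -> fgca (Tot N)) :
  is_algmor f -> is_algmor f' ->
  f @` positive_part M `<=` tot_positive N ->
  f' @` positive_part M `<=` tot_positive N ->
  trd_adjoint f = trd_adjoint f' -> f = f'.
Proof.
move=> fm fm' fpos fpos' E; apply/funext => a.
apply: matches_inj (trd_adjoint_matches fm fpos a) _.
by rewrite E; exact: trd_adjoint_matches.
Qed.

(** ** The inverse correspondence *)

Section Coadjoint.
Variables (g : fgca (trd_gens k M) -> fgca N) (gm : is_algmor g).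
Let lg : linear g := algmor_linear gm.

(** The operator prod_{i in L} (1 - sw_i s_i) applied to x, followed by g: the
    exponential of - sum_i sw_i s_i, that is, the Taylor series whose
    coefficients are the g (s_{i_1} ... s_{i_r} x). *)
Fixpoint taylor (L : seq 'I_k) (x : fgca (trd_gens k M)) : fgca (Tot N) :=
  if L is i :: L' then taylor L' x - sw N i * taylor L' (s_op i x) else tot_N (g x).

Lemma taylor_linear L : linear (taylor L).
Proof.
elim: L => [|i L IH] c u v /=; first by rewrite lg (algmor_linear (tot_NP N).1).
rewrite (der_linear (s_opP i)) !IH mulrDr -scalerAr opprD addrACA.
by rewrite -scalerBr.
Qed.

Lemma contr_taylor L i x : uniq L ->
  contr i (taylor L x) = if i \in L then taylor L (s_op i x) else 0.
Proof.
elim: L x => [|j L IH] x /=; first by rewrite contr_N.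
case/andP=> jL uL; rewrite (linD _ _ (contr_linear i)) (linN (contr_linear i)).
rewrite contr_sw !IH // inE.
case: (eqVneq j i) jL => [->|ji] jL.
  rewrite (negbTE jL) /= mulr0 subr0 sub0r opprK.
  rewrite (anticomm_sq (@s_op_anticommuting k M)) (lin0 (taylor_linear L)).
  by rewrite mulr0 subr0.
rewrite sub0r opprK /=; case: ifP => _; last by rewrite mulr0 addr0.
rewrite (anticommN (@s_op_anticommuting k M) i j) (linN (taylor_linear L)).
by rewrite mulrN.
Qed.

Lemma tot_aug_taylor L x : tot_aug (taylor L x) = g x.
Proof.
have [[lf _ fM _] fv] := tot_augP N.
elim: L x => [|i L IH] x /=; first exact: tot_aug_N.
by rewrite (linB lf) fM fv mul0r subr0.
Qed.

Lemma taylor_homog L n x : homog n x -> homog n (taylor L x).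
Proof.
elim: L n x => [|i L IH] n x Hx /=.
  have [_ _ _ nh] := (tot_NP N).1; have [_ _ _ gh] := gm.
  by apply: nh; exact: gh.
apply: hg_add; first exact: IH.
rewrite -scaleN1r; apply: hg_scale; rewrite -[n](addrNK 1) addrC.
by apply: hg_mul; [exact: sw_homog | apply: IH; have [_ h _] := @s_opP k M i; exact: h].
Qed.

Definition trd_coadjoint := taylor (enum 'I_k) \o @trd_S k M.

Lemma taylor_matches x : matches g x (taylor (enum 'I_k) x).
Proof.
move=> l; rewrite -(tot_aug_taylor (enum 'I_k)); congr tot_aug.
elim: l => //= i l <-; rewrite contr_taylor ?enum_uniq //.
by rewrite mem_enum.
Qed.

(** Multiplicativity follows from uniqueness: the series of x y and the product
    of the two series are both matched with x y. *)
Lemma taylor_algmor : is_algmor (taylor (enum 'I_k)).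
Proof.
split=> [||x y|n x]; first exact: taylor_linear.
- exact: matches_inj (taylor_matches 1) (matches_const gm).
- apply: matches_inj (taylor_matches (x * y)) _.
  by apply: matchesM => //; exact: taylor_matches.
- exact: taylor_homog.
Qed.
End Coadjoint.

(** ** Differentials *)

Variables (d : fgca (trd_gens k M) -> fgca (trd_gens k M)) (Hd : is_trd_diff d).

(** The untwisted part of d_t, which extends the differential of M and still
    anticommutes with the s_i. *)
Definition trd_diff0 (x : fgca (trd_gens k M)) :=
  d x - \sum_(i < k) w _ i * s_op i x.

Lemma trd_diff0_S a : trd_diff0 (trd_S k a) = trd_S k (diff a).
Proof. by rewrite /trd_diff0 (trd_diff_S Hd) addrK. Qed.

Lemma trd_diff0_s i x : trd_diff0 (s_op i x) = - s_op i (trd_diff0 x).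
Proof.
have [_ _ ds _] := Hd; have lsi := der_linear (s_opP (V := M) i).
rewrite /trd_diff0 (linB lsi) opprB (lin_sum lsi) [RHS]addrC.
congr (_ + _); first by apply/eqP; rewrite -addr_eq0; apply/eqP; exact: ds.
rewrite -sumrN; apply: eq_bigr => j _; rewrite s_op_wM -mulrN; congr (_ * _).
by rewrite (anticommN (@s_op_anticommuting k M)) opprK.
Qed.

(** On the augmentation this is diff_tot_aug; contractions and the s_i pass
    through the two differentials with the same sign. *)
Lemma matches_diff (g : fgca (trd_gens k M) -> fgca N) x y :
  dhomW (Trd Hd) N g -> matches g x y -> matches g (trd_diff0 x) (diff y).
Proof.
case=> [[gm gd] gw] H l; elim/last_ind: l x y H => [|l i IH] x y H.
  have [lg _ gM _] := gm.
  rewrite /trd_diff0 (linB lg) [g (d x)](gd x) (lin_sum lg).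
  rewrite [g x](H [::]) diff_tot_aug -[RHS]addr0 -addrA; congr (_ + _).
  apply/eqP; rewrite subr_eq0; apply/eqP; apply: eq_bigr => i _.
  by rewrite gM gw [g _](H [:: i]).
have := IH _ _ (matches_s i H); rewrite !foldr_rcons trd_diff0_s contr_diff.
rewrite !(linN (foldr_anticomm_linear (@s_op_anticommuting k M) l)).
rewrite !(linN (foldr_anticomm_linear (@contr_anticomm k N) l)).
rewrite (linN (algmor_linear gm)) (linN (algmor_linear (tot_augP N).1)) => E.
by rewrite -E opprK.
Qed.

(** The converse of the computation in matches_diff: if trd_diff0 x is matched
    with the differential of y, then g commutes with the differential at x.  The
    hypothesis passes from x to s_i x, hence from v to all generators s_J v. *)
Lemma trd_adjoint_dhomW (f : fgca M -> fgca (Tot N)) :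
  dhom0 M N f -> dhomW (Trd Hd) N (trd_adjoint f).
Proof.
case=> [[fm fd] fpos]; have [gm gv] := trd_adjointP fm.
have gw i : trd_adjoint f (w _ i) = w _ i by exact: gv.
have [lg _ gM _] := gm.
have [d_der _ _ dw] := Hd.
split; last exact: gw.
split=> // x; apply/esym.
apply: (der_algmor gm d_der (diffP N)) => -[p|i]; last first.
  by rewrite dw gw (lin0 lg) [LHS](diffW_w N i).
rewrite sgen_var; move: (val p) => [J v] /=; rewrite -foldr_s_op_sgen -trd_S_var.
set X := foldr _ _ _; pose Y := foldr (@contr k N) (f (var v)) (enum J).
have [H1 H2] : matches (trd_adjoint f) X Y /\
    matches (trd_adjoint f) (trd_diff0 X) (diff Y).
  rewrite {}/X {}/Y; elim: (enum J) => [|i l [IH1 IH2]].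
    split; first exact: trd_adjoint_matches.
    have := trd_adjoint_matches fm fpos (diff (var v)).
    by rewrite fd -trd_diff0_S.
  split; first exact: matches_s.
  by have := matchesN gm (matches_s i IH2); rewrite -trd_diff0_s contr_diff opprK.
have E0 : trd_adjoint f X = tot_aug Y := H1 [::].
have E1 i : trd_adjoint f (s_op i X) = tot_aug (contr i Y) := H1 [:: i].
have E2 : trd_adjoint f (trd_diff0 X) = tot_aug (diff Y) := H2 [::].
have dX : d X = trd_diff0 X + \sum_(i < k) w _ i * s_op i X by rewrite subrK.
rewrite dX (linD _ _ lg) E0 E2 (lin_sum lg) [LHS]diff_tot_aug.
by congr (_ + _); apply: eq_bigr => i _; rewrite gM gw E1.
Qed.

(** The values on generators are positive, and the positive part of Trd_k(M) is an
    ideal, since Trd_k(M) is generated in positive degrees. *)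
Lemma s_op_positive i x : positive_part (Trd Hd) (s_op i x).
Proof.
apply: (derivation_positive (A := Trd Hd) _ (s_opP i)) => [[p|j]|[p|j]] //=.
- exact: (valP p).
- rewrite sgen_var; case: (val p) => J v /=; rewrite s_op_sgen.
  case: ifP => _; first exact: span0.
  apply: spanZ; have [J0|J0] := boolP (0 < sdeg (i |: J, v)%SET).
    exact: (@positive_homog (Trd Hd) _ _ J0 (sgen_homog _ _)).
  by rewrite sgen_drop //; exact: span0.
- by rewrite s_op_w; exact: span0.
Qed.

Lemma trd_coadjoint_dhom0 g : dhomW (Trd Hd) N g -> dhom0 M N (trd_coadjoint g).
Proof.
move=> Hg; have [[gm gd] gw] := Hg; have Tm := taylor_algmor gm.
have fm := algmor_comp Tm (trd_SP k M).1.
split; first split=> // a.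
  transitivity (taylor g (enum 'I_k) (trd_diff0 (trd_S k a))).
    by rewrite trd_diff0_S.
  apply: matches_inj (taylor_matches gm _) _.
  exact: matches_diff Hg (taylor_matches gm _).
move=> _ [a Ha <-]; apply/tot_positiveP => l.
rewrite -[tot_aug _](taylor_matches gm).
apply: (algmor_positive (A := Trd Hd) gm).
case: l => [|i l] /=; last exact: s_op_positive.
exact: (algmor_positive (B := Trd Hd) (trd_SP k M).1).
Qed.

Lemma trd_adjoint_bij : set_bij (dhom0 M N) (dhomW (Trd Hd) N) (@trd_adjoint k M N).
Proof.
split.
- by move=> f; exact: trd_adjoint_dhomW.
- move=> f f' /set_mem[[fm _] fpos] /set_mem[[fm' _] fpos'].
  exact: trd_adjoint_inj.
- move=> g Hg; have H0 := trd_coadjoint_dhom0 Hg.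
  exists (trd_coadjoint g) => //; case: H0 => [[fm _] fpos].
  have [[gm0 _] gw] := Hg; have [hm hv] := trd_adjointP fm.
  apply: (algmor_eq hm gm0) => -[p|i]; last by rewrite hv gw.
  rewrite sgen_var; case: (val p) => J v /=; rewrite trd_adjoint_sgen //.
  by rewrite -foldr_s_op_sgen -trd_S_var [RHS](taylor_matches gm0).
Qed.
End Adjunction.

(** * Naturality *)

Section TotMap.
Variables (k : nat) (N N' : sdgcaW k) (psi : fgca N -> fgca N').
Hypothesis psim : is_algmor psi.

Lemma Tot_mapP : is_algmor (Tot_map psi) /\
  forall z : Tot N, Tot_map psi (var z) =
    match z with inl y => tot_N (psi (var y)) | inr i => sw N' i end.
Proof.
have [_ _ _ ph] := psim; have [_ _ _ nh] := (tot_NP N').1.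
apply: (@lift_algmor (Tot N) (Tot N')) => -[z|i]; last exact: sw_homog.
by apply: nh; apply: ph; exact: (hg_var z).
Qed.

Lemma tot_aug_map x : tot_aug (Tot_map psi x) = psi (tot_aug x).
Proof.
have [tm tv] := Tot_mapP; have [am av] := tot_augP N; have [am' av'] := tot_augP N'.
rewrite -[LHS]/((@tot_aug _ _ \o Tot_map psi) x) -[RHS]/((psi \o @tot_aug _ _) x).
congr (_ x); apply: (algmor_eq (algmor_comp am' tm) (algmor_comp psim am)) => -[z|i];
  rewrite /= tv av ?tot_aug_N // av'.
by rewrite (lin0 (algmor_linear psim)).
Qed.

Lemma contr_map i x : contr i (Tot_map psi x) = Tot_map psi (contr i x).
Proof.
have [tm tv] := Tot_mapP; have [lt t1 _ _] := tm.
apply: (der_algmor tm (contrP N i).1 (contrP N' i).1) => z.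
rewrite tv (contrP N i).2; case: z => [z|j]; first by rewrite contr_N (lin0 lt).
rewrite (contrP N' i).2; case: ifP => _; last by rewrite (lin0 lt).
by rewrite (linN lt) t1.
Qed.

Lemma tot_aug_foldr_map x l :
  tot_aug (foldr (@contr k N') (Tot_map psi x) l) =
  psi (tot_aug (foldr (@contr k N) x l)).
Proof.
rewrite -tot_aug_map; congr tot_aug.
by elim: l => //= i l ->; rewrite contr_map.
Qed.

Lemma Tot_map_positive x : tot_positive N x -> tot_positive N' (Tot_map psi x).
Proof.
move/tot_positiveP => Hx; apply/tot_positiveP => l.
by rewrite tot_aug_foldr_map; exact: algmor_positive.
Qed.

Lemma trd_adjoint_naturalN (V : gbasis) (f : fgca V -> fgca (Tot N)) :
  is_algmor f -> (forall i, psi (w _ i) = w _ i) ->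
  trd_adjoint (Tot_map psi \o f) = psi \o trd_adjoint f.
Proof.
move=> fm pw; have [gm gv] := trd_adjointP fm.
have [hm hv] := trd_adjointP (algmor_comp Tot_mapP.1 fm).
apply: (algmor_eq hm (algmor_comp psim gm)) => z.
rewrite hv -[RHS]/(psi (trd_adjoint f (var z))) gv.
case: z => [p|i]; last by rewrite pw.
by case: (val p) => J v; exact: tot_aug_foldr_map.
Qed.
End TotMap.

Section TrdMap.
Variables (k : nat) (M M' : sdgca) (phi : fgca M' -> fgca M).
Hypothesis phim : is_algmor phi.

Lemma foldr_s_op_homog (V : gbasis) n (x : fgca (trd_gens k V)) l :
  homog n x -> homog (n - (size l)%:Z) (foldr (@s_op k V) x l).
Proof.
move=> Hx; elim: l => [|i l IH] /=; first by rewrite subr0.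
have [_ h _] := @s_opP k V i.
by rewrite -addn1 PoszD opprD addrA; exact: h.
Qed.

Lemma Trd_mapP : is_algmor (@Trd_map k M' M phi) /\
  forall z : trd_gens k M', Trd_map phi (var z) =
    match z with
    | inl p =>
        let: (J, v) := val p in
        foldr (@s_op k M) (trd_S k (phi (var v))) (enum J)
    | inr i => w _ i
    end.
Proof.
have [_ _ _ ph] := phim; have [_ _ _ th] := (trd_SP k M).1.
apply: (@lift_algmor (trd_gens k M') (trd_gens k M)) => -[p|i]; last first.
  exact: (hg_var (inr i : trd_gens k M)).
rewrite /= /sdeg; case: (val p) => J v /=; rewrite cardE.
by apply: foldr_s_op_homog; apply: th; apply: ph; exact: hg_var.
Qed.

Lemma trd_adjoint_naturalM (N : sdgcaW k) (f : fgca M -> fgca (Tot N)) :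
  positively_generated M -> is_algmor f ->
  f @` positive_part M `<=` tot_positive N ->
  trd_adjoint (f \o phi) = trd_adjoint f \o Trd_map phi.
Proof.
move=> HM fm fpos; have [gm gv] := trd_adjointP fm.
have [hm hv] := trd_adjointP (algmor_comp fm phim); have [tm tv] := Trd_mapP.
apply: (algmor_eq hm (algmor_comp gm tm)) => z.
rewrite hv -[RHS]/(trd_adjoint f (Trd_map phi (var z))) tv.
case: z => [p|i]; last by rewrite gv.
by case: (val p) => J v; rewrite [RHS](trd_adjoint_matches HM fm fpos).
Qed.
End TrdMap.

(** * Cylinders *)

Section Renaming.
Implicit Types X Y Z : gbasis.

Lemma ren_comp X Y Z (f : Y -> Z) (g : X -> Y) :
  (forall y, deg (f y) = deg y) -> (forall x, deg (g x) = deg x) ->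
  ren f \o ren g = ren (f \o g).
Proof.
move=> Hf Hg; have [fm fv] := algmor_ren Hf; have [gm gv] := algmor_ren Hg.
have [cm cv] : is_algmor (ren (f \o g)) /\ forall x, ren (f \o g) (var x) = var (f (g x)).
  by apply: algmor_ren => x; rewrite /= Hf.
by apply: (algmor_eq (algmor_comp fm gm) cm) => x; rewrite /= gv fv cv.
Qed.

Lemma ren_cancel X Y (f : Y -> X) (g : X -> Y) :
  (forall y, deg (f y) = deg y) -> (forall x, deg (g x) = deg x) ->
  cancel g f -> cancel (ren g) (ren f).
Proof.
move=> Hf Hg gK a; rewrite -[LHS]/((ren f \o ren g) a) ren_comp //.
have [cm cv] : is_algmor (ren (f \o g)) /\ forall x, ren (f \o g) (var x) = var (f (g x)).
  by apply: algmor_ren => x; rewrite /= Hf.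
by rewrite (algmor_eq cm (@algmor_id _)) // => x; rewrite cv gK.
Qed.

Lemma derivation_transport X Y n (f : fgca X -> fgca Y) (g : fgca Y -> fgca X) D :
  is_algmor f -> is_algmor g -> cancel g f -> is_derivation n D ->
  is_derivation n (f \o D \o g).
Proof.
move=> [lf _ fM fh] [lg _ gM gh] gK [lD hD MD]; split=> [c a b|m a Ha|m a b Ha] /=.
- by rewrite lg lD lf.
- by apply: fh; apply: hD; exact: gh.
- rewrite gM (MD _ _ _ (gh _ _ Ha)) (linD _ _ lf) (linZ _ _ lf) !fM !gK //.
Qed.
End Renaming.

Lemma cyl_evP (A : sdgca) e : is_algmor (@cyl_ev A e) /\
  forall z : Cyl A, cyl_ev e (var z) =
    match z with inl y => var y | inr Ot => e%:A | inr Odt => 0 end.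
Proof.
apply: (@lift_algmor (Cyl A) A) => -[z|[]]; first exact: hg_var.
  by apply: hg_scale; exact: hg_one.
exact: hg_zero.
Qed.

Section RelativeCylinder.
Variables (k : nat) (N : sdgcaW k).

(** N (x) Omega(1) as an algebra over S(W): the generators of Omega(1) are moved
    to the relative generators. *)
Definition cylW_gens := gsum (gsum (rel_gens N) Omega1) (Wgen k).

Definition to_cylW (z : Cyl N) : cylW_gens :=
  match z with
  | inl (inl u) => inl (inl u)
  | inl (inr i) => inr i
  | inr o => inl (inr o)
  end.

Definition of_cylW (z : cylW_gens) : Cyl N :=
  match z with
  | inl (inl u) => inl (inl u)
  | inl (inr o) => inr o
  | inr i => inl (inr i)
  end.

Lemma to_cylW_deg z : deg (to_cylW z) = deg z.
Proof. by case: z => [[]|]. Qed.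

Lemma of_cylW_deg z : deg (of_cylW z) = deg z.
Proof. by case: z => [[]|]. Qed.

Lemma of_cylWK : cancel of_cylW to_cylW. Proof. by case=> [[]|]. Qed.
Lemma to_cylWK : cancel to_cylW of_cylW. Proof. by case=> [[]|]. Qed.

Lemma ren_to_cylWP : is_algmor (ren to_cylW) /\
  forall z, ren to_cylW (var z) = var (to_cylW z).
Proof. exact: algmor_ren to_cylW_deg. Qed.

Lemma ren_of_cylWP : is_algmor (ren of_cylW) /\
  forall z, ren of_cylW (var z) = var (of_cylW z).
Proof. exact: algmor_ren of_cylW_deg. Qed.

Lemma ren_of_cylWK : cancel (ren of_cylW) (ren to_cylW).
Proof. exact: ren_cancel to_cylW_deg of_cylW_deg of_cylWK. Qed.

Lemma ren_to_cylWK : cancel (ren to_cylW) (ren of_cylW).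
Proof. exact: ren_cancel of_cylW_deg to_cylW_deg to_cylWK. Qed.

Definition cylW_diff : fgca cylW_gens -> fgca cylW_gens :=
  ren to_cylW \o @cyl_diff N \o ren of_cylW.

Lemma cylW_diffP : is_derivation 1 cylW_diff.
Proof.
exact: derivation_transport ren_to_cylWP.1 ren_of_cylWP.1 ren_of_cylWK (cyl_diffP N).
Qed.

Lemma cylW_diff_sq a : cylW_diff (cylW_diff a) = 0.
Proof.
by rewrite /cylW_diff /= ren_to_cylWK cyl_diff_sq (lin0 (algmor_linear ren_to_cylWP.1)).
Qed.

Lemma cyl_AP (A : sdgca) : is_algmor (@cyl_A A) /\
  forall y, cyl_A (var y) = var (inl y : Cyl A).
Proof. exact: algmor_ren. Qed.

Lemma cylW_diff_w i : cylW_diff (w _ i) = 0.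
Proof.
rewrite /cylW_diff /= ren_of_cylWP.2 -(cyl_AP N).2 cyl_diff_A [diff _](diffW_w N i).
rewrite (lin0 (algmor_linear (cyl_AP N).1)).
by rewrite (lin0 (algmor_linear ren_to_cylWP.1)).
Qed.

Definition CylW : sdgcaW k := SDgcaW cylW_diffP cylW_diff_sq cylW_diff_w.

Lemma to_cylW_diff (a : fgca (Cyl N)) :
  ren to_cylW (diff a) = diff (ren to_cylW a : fgca CylW).
Proof. by rewrite /diff /= /cylW_diff /= ren_to_cylWK. Qed.

Lemma of_cylW_diff (a : fgca CylW) :
  ren of_cylW (diff a) = diff (ren of_cylW a : fgca (Cyl N)).
Proof. by rewrite /diff /= /cylW_diff /= ren_to_cylWK. Qed.

Definition cylW_ev (e : rat) : fgca CylW -> fgca N := cyl_ev e \o ren of_cylW.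

Lemma cylW_ev_algmor e : is_algmor (cylW_ev e).
Proof. exact: algmor_comp (cyl_evP N e).1 ren_of_cylWP.1. Qed.

Lemma cylW_ev_w e i : cylW_ev e (w _ i) = w _ i.
Proof. by rewrite /cylW_ev /= ren_of_cylWP.2 (cyl_evP N e).2. Qed.

(** ** The cylinder of the totalization *)

Definition cyl_tot (z : Cyl N) : Cyl (Tot N) :=
  match z with inl y => inl (inl y) | inr o => inr o end.

(** The isomorphism Tot N (x) Omega(1) = Tot (N (x) Omega(1)), on generators. *)
Definition swap_in (z : Cyl (Tot N)) : Tot CylW :=
  match z with
  | inl (inl y) => inl (to_cylW (inl y))
  | inl (inr i) => inr i
  | inr o => inl (to_cylW (inr o))
  end.

Definition swap_out (z : Tot CylW) : Cyl (Tot N) :=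
  match z with
  | inl y => cyl_tot (of_cylW y)
  | inr i => inl (inr i)
  end.

Lemma cyl_tot_deg z : deg (cyl_tot z) = deg z.
Proof. by case: z. Qed.

Lemma swap_in_deg z : deg (swap_in z) = deg z.
Proof. by case: z => [[[]|]|]. Qed.

Lemma swap_out_deg z : deg (swap_out z) = deg z.
Proof. by case: z => [[[]|]|]. Qed.

Lemma swap_inK : cancel swap_in swap_out. Proof. by case=> [[[]|]|]. Qed.
Lemma swap_outK : cancel swap_out swap_in. Proof. by case=> [[[]|]|]. Qed.

Lemma ren_swap_inP : is_algmor (ren swap_in) /\
  forall z, ren swap_in (var z) = var (swap_in z).
Proof. exact: algmor_ren swap_in_deg. Qed.

Lemma ren_swap_outP : is_algmor (ren swap_out) /\
  forall z, ren swap_out (var z) = var (swap_out z).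
Proof. exact: algmor_ren swap_out_deg. Qed.

Lemma ren_swap_inK : cancel (ren swap_in) (ren swap_out).
Proof. exact: ren_cancel swap_out_deg swap_in_deg swap_inK. Qed.

Lemma ren_swap_outK : cancel (ren swap_out) (ren swap_in).
Proof. exact: ren_cancel swap_in_deg swap_out_deg swap_outK. Qed.

Lemma swap_in_cyl_tot (a : fgca (Cyl N)) :
  ren swap_in (ren cyl_tot a) = @tot_N k CylW (ren to_cylW a).
Proof.
rewrite -[LHS]/((ren swap_in \o ren cyl_tot) a).
rewrite -[RHS]/((@tot_N k CylW \o ren to_cylW) a).
rewrite /tot_N !ren_comp //; first last.
- exact: cyl_tot_deg.
- exact: swap_in_deg.
- exact: to_cylW_deg.
by congr (ren _ a); apply/funext => -[].
Qed.

Lemma swap_in_cyl_sW (p : fgca (sWgen k)) :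
  ren swap_in (cyl_A (tot_sW N p : fgca (Tot N))) = tot_sW CylW p.
Proof.
have [sm sv] := tot_sWP N; have [cm cv] := cyl_AP (Tot N).
have [im iv] := ren_swap_inP; have [sm' sv'] := tot_sWP CylW.
rewrite -[LHS]/((ren swap_in \o (@cyl_A (Tot N) \o tot_sW N)) p).
congr (_ p).
apply: (algmor_eq (algmor_comp im (algmor_comp cm sm)) sm') => i /=.
by rewrite sv cv iv sv'.
Qed.

Lemma swap_in_cyl_N (a : fgca N) :
  ren swap_in (cyl_A (tot_N a : fgca (Tot N))) = @tot_N k CylW (ren to_cylW (cyl_A a)).
Proof.
rewrite -swap_in_cyl_tot; congr (ren swap_in).
rewrite -[LHS]/((@cyl_A (Tot N) \o @tot_N k N) a) -[RHS]/((ren cyl_tot \o @cyl_A N) a).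
by rewrite /cyl_A /tot_N !ren_comp //; exact: cyl_tot_deg.
Qed.

(** The differentials agree on generators: sw_i goes to w_i on both sides, and the
    remaining generators are those of N (x) Omega(1). *)
Lemma swap_in_diff (a : fgca (Cyl (Tot N))) :
  ren swap_in (diff a) = diff (ren swap_in a : fgca (Tot CylW)).
Proof.
have [im iv] := ren_swap_inP; have il := algmor_linear im.
apply/esym.
apply: (der_algmor im (diffP (Cyl (Tot N))) (diffP (Tot CylW))) => z.
have -> : diff (var z) = match z with
    | inl y => cyl_A (diff (var y)) | inr Ot => var (inr Odt : Cyl (Tot N))
    | inr Odt => 0 end :> fgca (Cyl (Tot N)).
  exact: (der_var (@cyl_diff_deg (Tot N))).
have dN (y : CylW) : diff (var (inl y : Tot CylW)) = tot_N (diff (var y))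
    :> fgca (Tot CylW).
  exact: (der_var (@tot_diff_deg k CylW)).
have dcyl (y : Cyl N) : diff (var (to_cylW y) : fgca CylW) = ren to_cylW (diff (var y)).
  by rewrite to_cylW_diff ren_to_cylWP.2.
have dcylv (y : Cyl N) : diff (var y) = match y with
    | inl y => cyl_A (diff (var y)) | inr Ot => var (inr Odt : Cyl N)
    | inr Odt => 0 end :> fgca (Cyl N).
  exact: (der_var (@cyl_diff_deg N)).
rewrite iv; case: z => [[y|i]|o].
- rewrite [LHS]dN dcyl dcylv -swap_in_cyl_N; congr (ren swap_in (cyl_A _)).
  exact/esym/(der_var (@tot_diff_deg k N)).
- rewrite [LHS](der_var (@tot_diff_deg k CylW)).
  have -> : diff (var (inr i : Tot N)) = tot_N (w _ i) :> fgca (Tot N).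
    exact: (der_var (@tot_diff_deg k N)).
  rewrite swap_in_cyl_N; congr tot_N.
  by rewrite (cyl_AP N).2 ren_to_cylWP.2.
- rewrite [LHS]dN dcyl dcylv; case: o.
    by rewrite ren_to_cylWP.2 (tot_NP CylW).2 iv.
  by rewrite (lin0 (algmor_linear ren_to_cylWP.1))
    (lin0 (algmor_linear (tot_NP CylW).1)) (lin0 il).
Qed.

Lemma swap_out_diff (a : fgca (Tot CylW)) :
  ren swap_out (diff a) = diff (ren swap_out a : fgca (Cyl (Tot N))).
Proof.
by apply: (can_inj ren_swap_inK); rewrite ren_swap_outK swap_in_diff ren_swap_outK.
Qed.

Lemma swap_in_positive a : tot_cyl_positive N a -> tot_positive CylW (ren swap_in a).
Proof.
have [im _] := ren_swap_inP; have [_ _ iM _] := im.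
apply: span_image => [|_ [b Hb [p _ <-]]]; first exact: algmor_linear.
rewrite iM swap_in_cyl_tot swap_in_cyl_sW; apply: span_base.
exists (ren to_cylW b); last by exists p.
exact: (algmor_positive (A := Cyl N) (B := CylW) ren_to_cylWP.1).
Qed.

Lemma swap_out_positive a : tot_positive CylW a -> tot_cyl_positive N (ren swap_out a).
Proof.
have [om _] := ren_swap_outP; have [_ _ oM _] := om.
apply: span_image => [|_ [b Hb [p _ <-]]]; first exact: algmor_linear.
rewrite -[b]ren_of_cylWK -swap_in_cyl_tot -swap_in_cyl_sW oM !ren_swap_inK.
apply: span_base; exists (ren of_cylW b); last by exists p.
exact: (algmor_positive (A := CylW) (B := Cyl N) ren_of_cylWP.1).
Qed.

(** Restriction of homotopies to t = e corresponds to the functoriality of Tot. *)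
Lemma Tot_map_cylW_ev e : Tot_map (cylW_ev e) \o ren swap_in = @cyl_ev (Tot N) e.
Proof.
have [im iv] := ren_swap_inP; have [em ev] := cyl_evP (Tot N) e.
have [tm tv] := Tot_mapP (cylW_ev_algmor e).
apply: (algmor_eq (algmor_comp tm im) em) => z; rewrite /= iv tv ev.
have evv (y : Cyl N) : cylW_ev e (var (to_cylW y)) =
    match y with inl y => var y | inr Ot => e%:A | inr Odt => 0 end.
  by rewrite /cylW_ev /= ren_of_cylWP.2 to_cylWK (cyl_evP N e).2.
have [nl n1 _ _] := (tot_NP N).1.
case: z => [[y|i]|o] //; rewrite /swap_in evv; first by rewrite (tot_NP N).2.
by case: o; rewrite ?(linZ _ _ nl) ?n1 ?(lin0 nl).
Qed.
End RelativeCylinder.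

(** * Homotopy classes *)

Section Homotopies.
Variables (k : nat) (M : sdgca) (N : sdgcaW k).
Variables (d : fgca (trd_gens k M) -> fgca (trd_gens k M)) (Hd : is_trd_diff d).
Hypothesis HM : positively_generated M.

Lemma trd_adjoint_ev e (h : fgca M -> fgca (Cyl (Tot N))) : is_algmor h ->
  trd_adjoint (cyl_ev e \o h) = cylW_ev e \o trd_adjoint (ren (@swap_in k N) \o h).
Proof.
move=> hm; rewrite -(Tot_map_cylW_ev N e) -compA trd_adjoint_naturalN //.
- exact: cylW_ev_algmor.
- exact: algmor_comp (ren_swap_inP N).1 hm.
- exact: cylW_ev_w.
Qed.

(** A homotopy h becomes, after exchanging Omega(1) and S(sW), a map in Hom^0 for
    N (x) Omega(1); the corresponding map out of Trd_k(M) is the homotopy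
    sought, by naturality. *)
Lemma trd_adjoint_homotopic (f f' : fgca M -> fgca (Tot N)) :
  homotopic0 M N f f' -> homotopicW N (Trd Hd) (trd_adjoint f) (trd_adjoint f').
Proof.
case=> f0 f0' [h [[hm hd] hpos h0 h1]].
pose h' := ren (@swap_in k N) \o h.
have Hh' : dhom0 M (CylW N) h'.
  split; first split.
  - exact: algmor_comp (ren_swap_inP N).1 hm.
  - by move=> a; rewrite -[LHS]/(ren (@swap_in k N) (h (diff a))) hd swap_in_diff.
  - by move=> _ [a Ha <-]; apply: swap_in_positive; apply: hpos; exists a.
have [[gm gd] gw] := trd_adjoint_dhomW HM Hd Hh'.
split; [exact: trd_adjoint_dhomW | exact: trd_adjoint_dhomW |].
exists (ren (@of_cylW k N) \o trd_adjoint h'); split.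
- split; first exact: algmor_comp (ren_of_cylWP N).1 gm.
  move=> a; rewrite -[LHS]/(ren (@of_cylW k N) (trd_adjoint h' (diff a))) gd.
  exact: of_cylW_diff.
- move=> i; rewrite -[LHS]/(ren (@of_cylW k N) (trd_adjoint h' (w _ i))) gw.
  by rewrite (ren_of_cylWP N).2 (cyl_AP N).2.
- by rewrite -h0 trd_adjoint_ev.
- by rewrite -h1 trd_adjoint_ev.
Qed.

(** The end points of the homotopy obtained from surjectivity for N (x) Omega(1)
    are identified by injectivity for N. *)
Lemma homotopic_trd_adjoint (f f' : fgca M -> fgca (Tot N)) :
  dhom0 M N f -> dhom0 M N f' ->
  homotopicW N (Trd Hd) (trd_adjoint f) (trd_adjoint f') -> homotopic0 M N f f'.
Proof.
move=> f0 f0' [_ _ [h [[hm hd] hw h0 h1]]].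
have [_ _ surj] := trd_adjoint_bij (CylW N) HM Hd.
have [|h' [[hm' hd'] hpos'] E] := surj (ren (@to_cylW k N) \o h).
  split; first split.
  - exact: algmor_comp (ren_to_cylWP N).1 hm.
  - by move=> a; rewrite -[LHS]/(ren (@to_cylW k N) (h (diff a))) hd to_cylW_diff.
  - move=> i; rewrite -[LHS]/(ren (@to_cylW k N) (h (w _ i))) hw.
    by rewrite (cyl_AP N).2 (ren_to_cylWP N).2.
have ev e f1 : dhom0 M N f1 -> cyl_ev e \o h = trd_adjoint f1 ->
    cyl_ev e \o (ren (@swap_out k N) \o h') = f1.
  move=> [[fm _] fpos] hf.
  have om : is_algmor (ren (@swap_out k N) \o h').
    exact: algmor_comp (ren_swap_outP N).1 hm'.
  have inout : ren (@swap_in k N) \o (ren (@swap_out k N) \o h') = h'.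
    by apply/funext => a; exact: ren_swap_outK.
  apply: (trd_adjoint_inj HM _ fm _ fpos).
  - exact: algmor_comp (cyl_evP (Tot N) e).1 om.
  - move=> _ [a Ha <-]; rewrite -(Tot_map_cylW_ev N e) -compA inout.
    apply: (Tot_map_positive (cylW_ev_algmor N e)).
    by apply: hpos'; exists a.
  - rewrite (trd_adjoint_ev _ om) inout E -hf; apply/funext => x.
    by rewrite /cylW_ev /= ren_to_cylWK.
split=> //; exists (ren (@swap_out k N) \o h'); split.
- split; first exact: algmor_comp (ren_swap_outP N).1 hm'.
  by move=> a; rewrite -[LHS]/(ren (@swap_out k N) (h' (diff a))) hd' swap_out_diff.
- by move=> _ [a Ha <-]; apply: swap_out_positive; apply: hpos'; exists a.
- exact: ev.
- exact: ev.
Qed.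
End Homotopies.

Section Classes.
Variables (T T' : Type) (H : set T) (H' : set T') (R : T -> T -> Prop).
Variables (R' : T' -> T' -> Prop) (F : T -> T').
Hypotheses (Fbij : set_bij H H' F) (R'H : forall x y, R' x y -> H' x /\ H' y).
Hypothesis RF : forall x y, R x y -> R' (F x) (F y).
Hypothesis FR : forall x y, H x -> H y -> R' (F x) (F y) -> R x y.

Let Finj x y : H x -> H y -> F x = F y -> x = y.
Proof. by case: Fbij => _ Fi _ Hx Hy; apply: Fi; apply: mem_set. Qed.

Lemma closure_image x y :
  clos_refl_sym_trans T R x y -> clos_refl_sym_trans T' R' (F x) (F y).
Proof.
elim=> [u v /RF|u|u v _|u v z _ IH1 _ IH2]; first exact: rst_step.
- exact: rst_refl.
- exact: rst_sym.
- exact: rst_trans IH1 IH2.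
Qed.

(** As R' relates elements of H' only, a chain of steps between F x and F y stays in
    the range of F and can be lifted step by step. *)
Lemma closure_preimage x y : H x -> H y ->
  clos_refl_sym_trans T' R' (F x) (F y) -> clos_refl_sym_trans T R x y.
Proof.
have [_ _ Fsurj] := Fbij.
suff S u v : clos_refl_sym_trans T' R' u v -> (H' u <-> H' v) /\
    forall x y, H x -> H y -> F x = u -> F y = v -> clos_refl_sym_trans T R x y.
  by move=> Hx Hy /S[_]; apply.
elim=> {u v x y} [u v uv|u|u v _ [e IH]|u v z _ [e1 IH1] _ [e2 IH2]].
- have [Hu Hv] := R'H uv; split=> // x y Hx Hy xu yv.
  by apply: rst_step; apply: FR; rewrite ?xu ?yv.
- by split=> // x y Hx Hy <- /(Finj Hy Hx) ->; exact: rst_refl.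
- by split=> [|x y Hx Hy xv yu]; [exact: iff_sym | apply: rst_sym; exact: IH].
split=> [|x y Hx Hy xu yz]; first exact: iff_trans e2.
have Hu : H' u by rewrite -xu; case: Fbij => + _ _; apply.
by have [t Ht tv] := Fsurj _ (e1.1 Hu); apply: rst_trans (IH1 _ _ Hx Ht xu tv) (IH2 _ _ Ht Hy tv yz).
Qed.

Lemma classes_bij : set_bij (classes H R) (classes H' R') (fun C => F @` C).
Proof.
have [Ffun _ Fsurj] := Fbij.
have FE x : H x -> F @` [set g | H g /\ clos_refl_sym_trans T R x g] =
    [set g | H' g /\ clos_refl_sym_trans T' R' (F x) g].
  move=> Hx; apply/seteqP; split=> [_ [y [Hy xy] <-]|z [Hz xz]] /=.
    by split; [exact: Ffun | exact: closure_image].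
  by have [y Hy yz] := Fsurj _ Hz; exists y => //; split=> //;
    apply: closure_preimage; rewrite ?yz.
split.
- move=> _ [x Hx ->]; exists (F x); [exact: Ffun | exact: FE].
- move=> C1 C2 /set_mem[x Hx E1] /set_mem[y Hy E2] E.
  have sub A B : A `<=` H -> B `<=` H -> F @` A = F @` B -> A `<=` B.
    move=> AH BH AB z Az; have : (F @` B) (F z) by rewrite -AB; exists z.
    by case=> t Bt /(Finj (BH _ Bt) (AH _ Az)) <-.
  by apply/seteqP; split; apply: sub => //; rewrite ?E1 ?E2 => z [].
- move=> _ [z Hz ->]; have [x Hx <-] := Fsurj _ Hz.
  by exists [set g | H g /\ clos_refl_sym_trans T R x g]; [exists x | exact: FE].
Qed.
End Classes.

Theorem corollary2p14 (k : nat) (hk : (1 <= k)%N) :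
  exists Phi : forall (M : sdgca) (N : sdgcaW k),
      (fgca M -> fgca (Tot N)) -> (fgca (trd_gens k M) -> fgca N),
  [/\ (* (i) and (ii): Phi is a bijection on maps and on homotopy classes *)
      forall (M : sdgca) (N : sdgcaW k)
             (d : fgca (trd_gens k M) -> fgca (trd_gens k M))
             (Hd : is_trd_diff d),
        positively_generated M ->
        set_bij (dhom0 M N) (dhomW (Trd Hd) N) (Phi M N) /\
        set_bij (classes (dhom0 M N) (homotopic0 M N))
                (classes (dhomW (Trd Hd) N) (homotopicW N (Trd Hd)))
                (fun C => Phi M N @` C),
      (* naturality in N *)
      forall (M : sdgca) (N N' : sdgcaW k)
             (d : fgca (trd_gens k M) -> fgca (trd_gens k M))
             (Hd : is_trd_diff d)
             (psi : fgca N -> fgca N') (f : fgca M -> fgca (Tot N)),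
        positively_generated M -> dhomW N N' psi -> dhom0 M N f ->
        Phi M N' (Tot_map psi \o f) = psi \o Phi M N f &
      (* naturality in M *)
      forall (M' M : sdgca) (N : sdgcaW k)
             (d' : fgca (trd_gens k M') -> fgca (trd_gens k M'))
             (Hd' : is_trd_diff d')
             (d : fgca (trd_gens k M) -> fgca (trd_gens k M))
             (Hd : is_trd_diff d)
             (phi : fgca M' -> fgca M) (f : fgca M -> fgca (Tot N)),
        positively_generated M' -> positively_generated M ->
        dhom M' M phi -> dhom0 M N f ->
        Phi M' N (f \o phi) = Phi M N f \o Trd_map phi].
Proof.

exists (fun M N f => trd_adjoint f); split.
- move=> M N d Hd HM; have B := trd_adjoint_bij N HM Hd; split=> //.
  apply: (classes_bij B) => [x y []|x y|x y] //.
  + exact: trd_adjoint_homotopic.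
  + exact: homotopic_trd_adjoint.
- move=> M N N' d Hd psi f _ [[psim _] psiw] [[fm _] _].
  exact: trd_adjoint_naturalN.
- move=> M' M N d' Hd' d Hd phi f _ HM [phim _] [[fm _] fpos].
  exact: trd_adjoint_naturalM.
Qed.
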